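(* Let $\mathbb{K}$ be an infinite field, $G$ an abelian group, $g\in G$ with $g\ne1$, and consider the $G$-grading $\Gamma(g,1)$ on $\mathrm{UT}_3^{(-)}(\mathbb{K})$. Then $\mathrm{Id}_G(\mathrm{UT}_3^{(-)},\Gamma(g,1))$ is generated, as a $T_G$-ideal, by (i) $x_{1,l}$, for $l\notin\{1,g\}$; (ii) $[z_1,z_2]$; (iii) $[[y_1,y_2],[y_3,y_4]]$; (iv) $[z_1,[y_2,y_3],[y_4,y_5]]$. Moreover, a basis of the relatively free algebra $\mathcal{L}(X^G)$ modulo $\mathrm{Id}_G(\mathrm{UT}_3^{(-)},\Gamma(g,1))$ is given by a basis $\mathcal{B}$ of the relatively free algebra of $\mathrm{UT}_2(\mathbb{K})^{(-)}$ in the variables $Y$, together with all commutators of type 1 and of type 2.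
   Context: $\mathrm{UT}_n^{(-)}=\mathrm{UT}_n(\mathbb{K})^{(-)}$ is the Lie algebra of upper triangular $n\times n$ matrices over $\mathbb{K}$ with bracket $[a,b]=ab-ba$; $e_{ij}$ are matrix units. For an abelian group $G$ (multiplicative, neutral element $1$) and $g,h\in G$, $\Gamma(g,h)$ is the $G$-grading on $\mathrm{UT}_3^{(-)}$ with $\deg e_{ii}=1$, $\deg e_{12}=g$, $\deg e_{23}=h$, $\deg e_{13}=gh$. $\mathcal{L}(X^G)$ is the free $G$-graded Lie algebra over $\mathbb{K}$ freely generated by $X^G=\{x_{i,g}\mid i\in\mathbb{N},g\in G\}$ with $\deg x_{i,g}=g$. Write $z_i=x_{i,g}$ and $y_i=x_{i,1}$, $Y=\{y_1,y_2,\ldots\}$; $z$ denotes any one of the $z_i$. Commutators are left-normed, and $[x,y^{(m)}]=[x,y,\ldots,y]$ with $y$ repeated $m$ times. $\mathrm{Id}_G(\mathrm{UT}_3^{(-)},\Gamma)$ is the set of $f\in\mathcal{L}(X^G)$ that vanish under every graded homomorphism $\mathcal{L}(X^G)\to(\mathrm{UT}_3^{(-)},\Gamma)$. A $T_G$-ideal is an ideal of $\mathcal{L}(X^G)$ invariant under all graded endomorphisms. $\mathcal{B}$ is a set of commutators (Lie monomials) in $\mathcal{L}(Y)$ whose images form a basis of the relatively free algebra $\mathcal{L}(Y)/\mathrm{Id}(\mathrm{UT}_2(\mathbb{K})^{(-)})$, where $\mathrm{Id}(\mathrm{UT}_2(\mathbb{K})^{(-)})$ is the ideal of ordinary Lie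 identities of $\mathrm{UT}_2(\mathbb{K})^{(-)}$ in the variables $Y$; $|m|$ denotes the length of a commutator $m$. A commutator of type 1 is $[z,y_{i_1}^{(k_1)},\ldots,y_{i_n}^{(k_n)}]$ with $i_1<\cdots<i_n$ and $k_i\ge0$ (for infinite $\mathbb{K}$ the exponents are unbounded). A commutator of type 2 is $[m,z,y_{i_1}^{(q_1)},\ldots,y_{i_n}^{(q_n)}]$ with $m\in\mathcal{B}$, $|m|\ge2$, $i_1<\cdots<i_n$, and $q_i\ge0$. *)

(* Defs.v *)
From HB Require Import structures.
From mathcomp Require Import all_boot all_order all_algebra.
From mathcomp Require Import ring.
From mathcomp Require Import boolp classical_sets functions cardinality.

Set Implicit Arguments.
Unset Strict Implicit.
Unset Printing Implicit Defensive.

Import GRing.Theory.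

Local Open Scope classical_set_scope.
Local Open Scope ring_scope.
Local Open Scope quotient_scope.

HB.mixin Record Lmodule_isLie (K : nzRingType) L of GRing.Lmodule K L := {
  lie : L -> L -> L;
  lieDl : forall a b c, lie (a + b) c = lie a c + lie b c;
  lieDr : forall a b c, lie a (b + c) = lie a b + lie a c;
  lieZl : forall (k : K) a b, lie (k *: a) b = k *: lie a b;
  lieZr : forall (k : K) a b, lie a (k *: b) = k *: lie a b;
  liexx : forall a, lie a a = 0;
  lie_jacobi : forall a b c,
    lie a (lie b c) + lie b (lie c a) + lie c (lie a b) = 0
}.

#[short(type="lieAlgType")]
HB.structure Definition LieAlgebra (K : nzRingType) :=
  { L of GRing.Lmodule K L & Lmodule_isLie K L }.

Section LieBasics.
Variable K : nzRingType.

Definition is_lie_hom (L A : lieAlgType K) (phi : L -> A) : Prop :=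
  linear phi /\ {morph phi : a b / lie a b}.

Definition is_lie_ideal (L : lieAlgType K) (I : set L) : Prop :=
  [/\ I 0,
      forall (k : K) a b, I a -> I b -> I (k *: a + b) &
      forall a b, I a -> I (lie a b) /\ I (lie b a)].

Definition lin_span (V : lmodType K) (S : set V) : set V :=
  [set v | exists n (c : 'I_n -> K) (e : 'I_n -> V),
     (forall i, S (e i)) /\ v = \sum_(i < n) c i *: e i].

(* The images of the family (e i), i in S, form a basis of V / J, for J a
   subspace of V; in particular e is injective modulo J on S. *)
Definition is_basis_mod (V : lmodType K) (J : set V)
    (I : choiceType) (e : I -> V) (S : set I) : Prop :=
  (forall (s : seq I) (c : I -> K),
     uniq s -> (forall i, i \in s -> S i) ->
     J (\sum_(i <- s) c i *: e i) -> forall i, i \in s -> c i = 0)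
  /\ (forall v : V, exists (s : seq I) (c : I -> K),
        (forall i, i \in s -> S i) /\ J (v - \sum_(i <- s) c i *: e i)).

End LieBasics.

Inductive lie_term (K X : Type) :=
| TVar of X
| TZero
| TAdd of lie_term K X & lie_term K X
| TScale of K & lie_term K X
| TLie of lie_term K X & lie_term K X.
Arguments TVar {K X}.
Arguments TZero {K X}.

HB.instance Definition _ K X := gen_eqMixin (lie_term K X).
HB.instance Definition _ K X := gen_choiceMixin (lie_term K X).

(* The congruence generated by the axioms of Lie algebras over K. *)
Inductive lie_eq (K : nzRingType) (X : Type) :
    lie_term K X -> lie_term K X -> Prop :=
| LE_refl t : lie_eq t t
| LE_sym t u : lie_eq t u -> lie_eq u t
| LE_trans t u v : lie_eq t u -> lie_eq u v -> lie_eq t v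
| LE_congD t t' u u' :
    lie_eq t t' -> lie_eq u u' -> lie_eq (TAdd t u) (TAdd t' u')
| LE_congZ k t t' : lie_eq t t' -> lie_eq (TScale k t) (TScale k t')
| LE_congL t t' u u' :
    lie_eq t t' -> lie_eq u u' -> lie_eq (TLie t u) (TLie t' u')
| LE_addA t u v : lie_eq (TAdd t (TAdd u v)) (TAdd (TAdd t u) v)
| LE_addC t u : lie_eq (TAdd t u) (TAdd u t)
| LE_add0 t : lie_eq (TAdd TZero t) t
| LE_addN t : lie_eq (TAdd (TScale (-1) t) t) TZero
| LE_scaleA a b t : lie_eq (TScale a (TScale b t)) (TScale (a * b) t)
| LE_scale1 t : lie_eq (TScale 1 t) t
| LE_scaleDr a t u :
    lie_eq (TScale a (TAdd t u)) (TAdd (TScale a t) (TScale a u))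
| LE_scaleDl a b t :
    lie_eq (TScale (a + b) t) (TAdd (TScale a t) (TScale b t))
| LE_lieDl t u v : lie_eq (TLie (TAdd t u) v) (TAdd (TLie t v) (TLie u v))
| LE_lieDr t u v : lie_eq (TLie t (TAdd u v)) (TAdd (TLie t u) (TLie t v))
| LE_lieZl a t u : lie_eq (TLie (TScale a t) u) (TScale a (TLie t u))
| LE_lieZr a t u : lie_eq (TLie t (TScale a u)) (TScale a (TLie t u))
| LE_liexx t : lie_eq (TLie t t) TZero
| LE_jacobi t u v :
    lie_eq (TAdd (TAdd (TLie t (TLie u v)) (TLie u (TLie v t)))
                 (TLie v (TLie t u))) TZero.

Section FreeLie.
Variables (K : nzRingType) (X : Type).

Definition lie_eqb (t u : lie_term K X) : bool := `[< lie_eq t u >].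

Lemma lie_eqb_refl : reflexive lie_eqb.
Proof. by move=> t; apply/asboolP; exact: LE_refl. Qed.
Lemma lie_eqb_sym : symmetric lie_eqb.
Proof. by move=> t u; apply/asboolP/asboolP; exact: LE_sym. Qed.
Lemma lie_eqb_trans : transitive lie_eqb.
Proof.
by move=> t u v /asboolP ut /asboolP tv; apply/asboolP; exact: LE_trans tv.
Qed.

Canonical lie_eqb_equiv :=
  EquivRel lie_eqb lie_eqb_refl lie_eqb_sym lie_eqb_trans.

Definition free_lie := {eq_quot lie_eqb_equiv}.
HB.instance Definition _ := Choice.on free_lie.

Definition lie_class (t : lie_term K X) : free_lie := \pi_free_lie t.

Lemma lie_classP t u : lie_class t = lie_class u <-> lie_eq t u.
Proof.
split=> [|tu]; first by move=> /eqquotP /asboolP.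
by apply/eqquotP/asboolP.
Qed.

Lemma lie_class_repr (a : free_lie) : lie_class (repr a) = a.
Proof. exact: reprK. Qed.

Definition fl_zero : free_lie := lie_class TZero.
Definition fl_add (a b : free_lie) := lie_class (TAdd (repr a) (repr b)).
Definition fl_scale k (a : free_lie) := lie_class (TScale k (repr a)).
Definition fl_opp := fl_scale (-1).
Definition fl_lie (a b : free_lie) := lie_class (TLie (repr a) (repr b)).

Lemma lie_class_surj (a : free_lie) : exists t, a = lie_class t.
Proof. by exists (repr a); rewrite lie_class_repr. Qed.

Lemma repr_class t : lie_eq (repr (lie_class t)) t.
Proof. by apply/lie_classP; rewrite lie_class_repr. Qed.

Lemma fl_addE t u : fl_add (lie_class t) (lie_class u) = lie_class (TAdd t u).
Proof. by apply/lie_classP/LE_congD; exact: repr_class. Qed.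
Lemma fl_scaleE k t : fl_scale k (lie_class t) = lie_class (TScale k t).
Proof. by apply/lie_classP/LE_congZ; exact: repr_class. Qed.
Lemma fl_lieE t u : fl_lie (lie_class t) (lie_class u) = lie_class (TLie t u).
Proof. by apply/lie_classP/LE_congL; exact: repr_class. Qed.

Let flE := (fl_addE, fl_scaleE, fl_lieE).

Fact fl_addA : associative fl_add.
Proof.
move=> a b c; have [[t ->] [u ->] [v ->]] :=
  And3 (lie_class_surj a) (lie_class_surj b) (lie_class_surj c).
by rewrite !flE; apply/lie_classP/LE_addA.
Qed.
Fact fl_addC : commutative fl_add.
Proof.
move=> a b; have [[t ->] [u ->]] := conj (lie_class_surj a) (lie_class_surj b).
by rewrite !flE; apply/lie_classP/LE_addC.
Qed.
Fact fl_add0 : left_id fl_zero fl_add.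
Proof.
by move=> a; have [t ->] := lie_class_surj a; rewrite flE; apply/lie_classP/LE_add0.
Qed.
Fact fl_addN : left_inverse fl_zero fl_opp fl_add.
Proof.
move=> a; have [t ->] := lie_class_surj a.
by rewrite /fl_opp !flE; apply/lie_classP/LE_addN.
Qed.

HB.instance Definition _ :=
  GRing.isZmodule.Build free_lie fl_addA fl_addC fl_add0 fl_addN.

Fact fl_scaleA a b v : fl_scale a (fl_scale b v) = fl_scale (a * b) v.
Proof.
have [t ->] := lie_class_surj v.
by rewrite !flE; apply/lie_classP/LE_scaleA.
Qed.
Fact fl_scale1 : left_id 1 fl_scale.
Proof.
by move=> a; have [t ->] := lie_class_surj a; rewrite flE; apply/lie_classP/LE_scale1.
Qed.
Fact fl_scaleDr : right_distributive fl_scale +%R.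
Proof.
move=> k a b; rewrite /GRing.add /=.
have [[t ->] [u ->]] := conj (lie_class_surj a) (lie_class_surj b).
by rewrite !flE; apply/lie_classP/LE_scaleDr.
Qed.
Fact fl_scaleDl v : {morph fl_scale^~ v : a b / a + b}.
Proof.
move=> a b; rewrite [RHS]/GRing.add /=; have [t ->] := lie_class_surj v.
by rewrite !flE; apply/lie_classP/LE_scaleDl.
Qed.

HB.instance Definition _ := GRing.Zmodule_isLmodule.Build K free_lie
  fl_scaleA fl_scale1 fl_scaleDr fl_scaleDl.

Fact fl_lieDl a b c : fl_lie (a + b) c = fl_lie a c + fl_lie b c.
Proof.
have [[t ->] [u ->] [v ->]] :=
  And3 (lie_class_surj a) (lie_class_surj b) (lie_class_surj c).
by rewrite /GRing.add /= !flE; apply/lie_classP/LE_lieDl.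
Qed.
Fact fl_lieDr a b c : fl_lie a (b + c) = fl_lie a b + fl_lie a c.
Proof.
have [[t ->] [u ->] [v ->]] :=
  And3 (lie_class_surj a) (lie_class_surj b) (lie_class_surj c).
by rewrite /GRing.add /= !flE; apply/lie_classP/LE_lieDr.
Qed.
Fact fl_lieZl (k : K) a b : fl_lie (k *: a) b = k *: fl_lie a b.
Proof.
have [[t ->] [u ->]] := conj (lie_class_surj a) (lie_class_surj b).
by rewrite /GRing.scale /= !flE; apply/lie_classP/LE_lieZl.
Qed.
Fact fl_lieZr (k : K) a b : fl_lie a (k *: b) = k *: fl_lie a b.
Proof.
have [[t ->] [u ->]] := conj (lie_class_surj a) (lie_class_surj b).
by rewrite /GRing.scale /= !flE; apply/lie_classP/LE_lieZr.
Qed.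
Fact fl_liexx a : fl_lie a a = 0.
Proof.
by have [t ->] := lie_class_surj a; rewrite flE; apply/lie_classP/LE_liexx.
Qed.
Fact fl_jacobi a b c :
  fl_lie a (fl_lie b c) + fl_lie b (fl_lie c a) + fl_lie c (fl_lie a b) = 0.
Proof.
have [[t ->] [u ->] [v ->]] :=
  And3 (lie_class_surj a) (lie_class_surj b) (lie_class_surj c).
by rewrite /GRing.add /= !flE; apply/lie_classP/LE_jacobi.
Qed.

HB.instance Definition _ := Lmodule_isLie.Build K free_lie
  fl_lieDl fl_lieDr fl_lieZl fl_lieZr fl_liexx fl_jacobi.

Definition fl_var (x : X) : free_lie := lie_class (TVar x).

End FreeLie.

Arguments fl_var K {X} x.

Section UniversalProperty.
Variables (K : nzRingType) (X : Type) (A : lieAlgType K) (f : X -> A).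

Fixpoint term_eval (t : lie_term K X) : A :=
  match t with
  | TVar x => f x
  | TZero => 0
  | TAdd t u => term_eval t + term_eval u
  | TScale k t => k *: term_eval t
  | TLie t u => lie (term_eval t) (term_eval u)
  end.

Lemma term_eval_eq t u : lie_eq t u -> term_eval t = term_eval u.
Proof.
elim=> //=.
- by move=> t1 u1 v1 _ -> _ ->.
- by move=> t1 t2 u1 u2 _ -> _ ->.
- by move=> k t1 t2 _ ->.
- by move=> t1 t2 u1 u2 _ -> _ ->.
- by move=> *; rewrite addrA.
- by move=> *; rewrite addrC.
- by move=> *; rewrite add0r.
- by move=> *; rewrite scaleN1r addNr.
- by move=> *; rewrite scalerA.
- by move=> *; rewrite scale1r.
- by move=> *; rewrite scalerDr.
- by move=> *; rewrite scalerDl.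
- by move=> *; rewrite lieDl.
- by move=> *; rewrite lieDr.
- by move=> *; rewrite lieZl.
- by move=> *; rewrite lieZr.
- by move=> *; rewrite liexx.
- by move=> *; rewrite lie_jacobi.
Qed.

Definition fl_lift (a : free_lie K X) : A := term_eval (repr a).

Lemma fl_lift_class t : fl_lift (lie_class t) = term_eval t.
Proof. exact/term_eval_eq/repr_class. Qed.

Lemma fl_lift_var x : fl_lift (fl_var K x) = f x.
Proof. exact: fl_lift_class. Qed.

Lemma fl_lift_hom : is_lie_hom fl_lift.
Proof.
split=> [k a b|a b]; rewrite -(lie_class_repr a) -(lie_class_repr b).
  rewrite /GRing.scale/= /GRing.add/= fl_scaleE fl_addE.
  by rewrite !fl_lift_class.
by rewrite /lie/= fl_lieE !fl_lift_class.
Qed.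

Lemma fl_lift_unique (phi : free_lie K X -> A) :
  is_lie_hom phi -> (forall x, phi (fl_var K x) = f x) -> phi =1 fl_lift.
Proof.
move=> [phi_lin phi_lie] phi_var.
have phi0 : phi 0 = 0.
  by have := phi_lin (-1) 0 0; rewrite scaler0 addr0 scaleN1r addNr.
have phiD a b : phi (a + b) = phi a + phi b.
  by have := phi_lin 1 a b; rewrite !scale1r.
have phiZ k a : phi (k *: a) = k *: phi a.
  by have := phi_lin k a 0; rewrite phi0 !addr0.
move=> a; rewrite -(lie_class_repr a) fl_lift_class.
elim: (repr a) => //= [t IHt u IHu|k t IHt|t IHt u IHu].
- by rewrite -fl_addE phiD IHt IHu.
- by rewrite -fl_scaleE phiZ IHt.
- by rewrite -fl_lieE phi_lie IHt IHu.
Qed.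

End UniversalProperty.

(* Commutators are kept as formal bracketings of variables, so that their
   length and the variables they involve are meaningful. *)
Inductive lie_mon (X : Type) :=
| MVar of X
| MLie of lie_mon X & lie_mon X.

HB.instance Definition _ X := gen_eqMixin (lie_mon X).
HB.instance Definition _ X := gen_choiceMixin (lie_mon X).

Fixpoint mon_length X (m : lie_mon X) : nat :=
  match m with
  | MVar _ => 1
  | MLie m1 m2 => mon_length m1 + mon_length m2
  end.

Fixpoint mon_map X Y (f : X -> Y) (m : lie_mon X) : lie_mon Y :=
  match m with
  | MVar x => MVar (f x)
  | MLie m1 m2 => MLie (mon_map f m1) (mon_map f m2)
  end.

Fixpoint mon_eval (K : nzRingType) X (m : lie_mon X) : free_lie K X :=
  match m with
  | MVar x => fl_var K x
  | MLie m1 m2 => lie (mon_eval K m1) (mon_eval K m2)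
  end.

Definition left_normed X (m : lie_mon X) (s : seq X) : lie_mon X :=
  foldl (fun c x => MLie c (MVar x)) m s.

Definition is_graded_hom (K : nzRingType) (G : Type) (L A : lieAlgType K)
    (Lc : G -> set L) (Ac : G -> set A) (phi : L -> A) : Prop :=
  is_lie_hom phi /\ forall d a, Lc d a -> Ac d (phi a).

Definition identities (K : nzRingType) (A : lieAlgType K) (X : Type) :
    set (free_lie K X) :=
  [set f | forall phi : free_lie K X -> A, is_lie_hom phi -> phi f = 0].

Section GradedFree.
Variables (K : nzRingType) (G : groupType).

(* The pair (i, d) stands for the variable x_{i,d}, of degree d. *)
Definition graded_free_lie := free_lie K (nat * G).
HB.instance Definition _ := LieAlgebra.on graded_free_lie.

Fixpoint mon_deg (m : lie_mon (nat * G)) : G :=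
  match m with
  | MVar x => x.2
  | MLie m1 m2 => (mon_deg m1 * mon_deg m2)%g
  end.

Definition free_comp (d : G) : set graded_free_lie :=
  lin_span [set mon_eval K m | m in [set m | mon_deg m = d]].

Definition graded_identities (A : lieAlgType K) (Ac : G -> set A) :
    set graded_free_lie :=
  [set f | forall phi : graded_free_lie -> A,
     is_graded_hom free_comp Ac phi -> phi f = 0].

Definition is_TG_ideal (I : set graded_free_lie) : Prop :=
  is_lie_ideal I /\
  forall phi : graded_free_lie -> graded_free_lie,
    is_graded_hom free_comp free_comp phi -> forall f, I f -> I (phi f).

(* The sequence y_{i_1}^{(k_1)}, ..., y_{i_n}^{(k_n)} attached to
   s = [(i_1, k_1); ...; (i_n, k_n)]. *)
Definition y_powers (s : seq (nat * nat)) : seq (nat * G) :=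
  flatten [seq nseq p.2 (p.1, 1%g) | p <- s].

Definition type1 (g : G) : set (lie_mon (nat * G)) :=
  [set c | exists (j : nat) (s : seq (nat * nat)),
     sorted ltn (map fst s) /\ c = left_normed (MVar (j, g)) (y_powers s)].

(* B is a set of commutators in the variables y_i, given by their indices. *)
Definition type2 (g : G) (B : set (lie_mon nat)) : set (lie_mon (nat * G)) :=
  [set c | exists (m : lie_mon nat) (j : nat) (s : seq (nat * nat)),
     [/\ B m, (2 <= mon_length m)%N, sorted ltn (map fst s) &
         c = left_normed
               (MLie (mon_map (fun i => (i, 1%g)) m) (MVar (j, g)))
               (y_powers s)]].

End GradedFree.

Section UpperTriangular.
Variables (K : comNzRingType) (n : nat).

Definition upper_tri : {pred 'M[K]_n} :=
  [pred A : 'M[K]_n | [forall i : 'I_n, forall j : 'I_n, (j < i)%N ==> (A i j == 0)]].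

Lemma upper_triP (A : 'M[K]_n) :
  reflect (forall i j : 'I_n, (j < i)%N -> A i j = 0) (A \in upper_tri).
Proof.
apply: (iffP idP) => [/forallP H i j ji|H].
  by have /forallP/(_ j)/implyP/(_ ji)/eqP := H i.
by apply/forallP => i; apply/forallP => j; apply/implyP => ji; rewrite H.
Qed.

Fact upper_tri_submod : submod_closed upper_tri.
Proof.
split=> [|k A B /upper_triP HA /upper_triP HB]; apply/upper_triP => i j ji.
  by rewrite mxE.
by rewrite !mxE HA // HB // mulr0 addr0.
Qed.
HB.instance Definition _ :=
  GRing.isSubmodClosed.Build K 'M[K]_n upper_tri upper_tri_submod.

Lemma upper_tri_mul (A B : 'M[K]_n) :
  A \in upper_tri -> B \in upper_tri -> A *m B \in upper_tri.
Proof.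
move=> /upper_triP HA /upper_triP HB; apply/upper_triP => i j ji.
rewrite mxE big1 // => k _; case: (ltnP k i) => ki; first by rewrite HA ?mul0r.
by rewrite HB ?mulr0 //; exact: leq_trans ki.
Qed.

Definition UT := {A : 'M[K]_n | A \in upper_tri}.
HB.instance Definition _ := SubChoice.on UT.
HB.instance Definition _ := [SubChoice_isSubLmodule of UT by <:].

Fact UT_lie_subproof (a b : UT) :
  val a *m val b - val b *m val a \in upper_tri.
Proof. by apply: rpredB; apply: upper_tri_mul; apply: valP. Qed.

Definition UT_lie (a b : UT) : UT :=
  exist (fun A => A \in upper_tri) _ (UT_lie_subproof a b).

Let UT_lieE a b : val (UT_lie a b) = val a *m val b - val b *m val a.
Proof. by []. Qed.

Let UT_valD (a b : UT) : val (a + b) = val a + val b.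
Proof. by []. Qed.
Let UT_valZ (k : K) (a : UT) : val (k *: a) = k *: val a.
Proof. by []. Qed.

Fact UT_lieDl a b c : UT_lie (a + b) c = UT_lie a c + UT_lie b c.
Proof.
apply: val_inj; rewrite UT_valD !UT_lieE UT_valD mulmxDl mulmxDr opprD.
by rewrite addrACA.
Qed.
Fact UT_lieDr a b c : UT_lie a (b + c) = UT_lie a b + UT_lie a c.
Proof.
apply: val_inj; rewrite UT_valD !UT_lieE UT_valD mulmxDl mulmxDr opprD.
by rewrite addrACA.
Qed.
Fact UT_lieZl (k : K) a b : UT_lie (k *: a) b = k *: UT_lie a b.
Proof.
apply: val_inj; rewrite UT_valZ !UT_lieE UT_valZ.
by rewrite -scalemxAl -scalemxAr scalerBr.
Qed.
Fact UT_lieZr (k : K) a b : UT_lie a (k *: b) = k *: UT_lie a b.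
Proof.
apply: val_inj; rewrite UT_valZ !UT_lieE UT_valZ.
by rewrite -scalemxAl -scalemxAr scalerBr.
Qed.
Fact UT_liexx a : UT_lie a a = 0.
Proof. by apply: val_inj; rewrite UT_lieE subrr. Qed.
Fact UT_jacobi a b c :
  UT_lie a (UT_lie b c) + UT_lie b (UT_lie c a) + UT_lie c (UT_lie a b) = 0.
Proof.
apply: val_inj; rewrite !UT_valD !UT_lieE.
rewrite [RHS](_ : _ = 0 :> 'M[K]_n) //.
move: (val a) (val b) (val c) => A B C.
rewrite !(mulmxBl, mulmxBr) !mulmxA.
move: (A *m B *m C) (A *m C *m B) (B *m A *m C) => ABC ACB BAC.
move: (B *m C *m A) (C *m A *m B) (C *m B *m A) => BCA CAB CBA.
by apply/matrixP => i j; rewrite !mxE; ring.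
Qed.

HB.instance Definition _ := Lmodule_isLie.Build K UT
  UT_lieDl UT_lieDr UT_lieZl UT_lieZr UT_liexx UT_jacobi.

End UpperTriangular.

Section Gamma.
Variables (K : comNzRingType) (G : groupType) (g h : G).

Definition Gamma_deg (i j : 'I_3) : G :=
  match nat_of_ord i, nat_of_ord j with
  | 0, 1 => g
  | 1, 2 => h
  | 0, 2 => (g * h)%g
  | _, _ => 1%g
  end.

(* Rows and columns are numbered from 0, so (0, 1) stands for e_12. *)
Definition Gamma (d : G) : set (UT K 3) :=
  lin_span [set a : UT K 3 | exists i j : 'I_3,
    [/\ (i <= j)%N, val a = delta_mx i j & Gamma_deg i j = d]].

End Gamma.
Arguments Gamma K {G} g h d _.

(* Main.v *)
(** Let J be the T_G-ideal generated by (i)-(iv); it lies in Id, so it suffices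
    that the proposed commutators span L(X^G) modulo J and are independent
    modulo Id: this yields both Id = J and the basis.

    Spanning: modulo J, the free algebra is L(Y) plus the span of the words
    [z, y_i1, ..., y_in]; reordering the y's costs terms with a factor in L(Y)',
    and by (iv) such a factor can occur only once, so it can be moved next to z
    and expanded in B, and the remaining y's then commute.

    Independence: under Gamma(g,1), the y's act on the row vectors (e_12, e_13)
    through generic matrices of UT_2.  The e_12 entry sees only type 1, as a
    monomial in the first diagonal entries.  The e_13 entry turns [m, z, y^q]
    into m_12 times a monomial in the second diagonal entries, and these can be
    varied freely without changing m_12, by adding scalars to the y's.

    That some B exists, and that the metabelian identity generates the
    identities of UT_2, both follow from the classical basis consisting of the
    y_i and the [y_i, y_j, y_k1, ..., y_kr] with i > j <= k1 <= ... <= kr. *)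
Require Import Defs.
From mathcomp Require Import all_boot all_order all_algebra.
From mathcomp Require Import ring.
From mathcomp Require Import boolp classical_sets functions cardinality.

Set Implicit Arguments.
Unset Strict Implicit.
Unset Printing Implicit Defensive.

Import GRing.Theory.

Local Open Scope classical_set_scope.
Local Open Scope ring_scope.

(** * Polynomial functions over an infinite field *)

Section InfiniteField.
Variables (K : fieldType) (K_infinite : infinite_set [set: K]).

Lemma infinite_uniq_seq (n : nat) : exists s : seq K, uniq s /\ size s = n.
Proof.
elim: n => [|n [s [us <-]]]; first by exists [::].
suff [a /negP sa] : exists a, ~ a \in s by exists (a :: s); rewrite /= sa us.
apply/not_existsP => all_in; apply: K_infinite; apply/finite_seqP; exists s.
by apply/seteqP; split=> // a _; have := all_in a; apply: contra_notP.
Qed.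

Lemma horner_eq0_poly (p : {poly K}) : (forall a, p.[a] = 0) -> p = 0.
Proof.
move=> p0; have [s [us sz]] := infinite_uniq_seq (size p).
apply/eqP/negPn/negP => pn0.
have roots_s : all (root p) s by apply/allP => a _; apply/eqP/p0.
by have := max_poly_roots pn0 roots_s us; rewrite sz ltnn.
Qed.

(** Distinct [x] may share an exponent vector, so only the sum of the coefficients over the fibre of
    [f] can vanish. Induction on the number of variables: with the others fixed, the expression is a
    polynomial in the last variable that vanishes on an infinite field. *)
Lemma multipoly_coef_eq0 (I : Type) (n : nat) (e : I -> nat -> nat) (s : seq I)
    (a : I -> K) (f : nat -> nat) :
  (forall t : nat -> K,
     \sum_(x <- s) a x * \prod_(i <- iota 0 n) t i ^+ e x i = 0) ->
  \sum_(x <- s | all (fun i => e x i == f i) (iota 0 n)) a x = 0.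
Proof.
elim: n s => [|n IHn] s vanish.
  rewrite -[RHS](vanish (fun=> 0)); apply: eq_bigr => x _.
  by rewrite big_nil mulr1.
rewrite -addn1 iotaD add0n.
under eq_bigl do rewrite all_cat /= andbT andbC.
rewrite -big_filter_cond; apply: IHn => t; rewrite big_filter.
pose p := \sum_(x <- s)
  (a x * \prod_(i <- iota 0 n) t i ^+ e x i) *: 'X^(e x n).
suff p0 : p = 0.
  have := congr1 (fun q : {poly K} => q`_(f n)) p0; rewrite coef0 coef_sum.
  apply: etrans.
  rewrite big_mkcond; apply: eq_bigr => x _; rewrite coefZ coefXn eq_sym.
  by case: eqP; rewrite ?mulr1 ?mulr0.
apply: horner_eq0_poly => c; rewrite /p horner_sum.
rewrite -[RHS](vanish (fun i => if i == n then c else t i)).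
apply: eq_bigr => x _; rewrite hornerZ hornerXn -addn1 iotaD big_cat /=.
rewrite big_seq1 eqxx -mulrA; congr (_ * (_ * _)).
rewrite [LHS]big_seq [RHS]big_seq; apply: eq_bigr => i; rewrite mem_iota /= add0n.
by move=> /ltn_eqF ->.
Qed.

(** Words stand for commutative monomials, and two words give the same monomial exactly when they
    are permutations of each other. Counting letters reduces the claim to exponent vectors. *)
Lemma word_poly_coef_eq0 (I : eqType) (s : seq I) (a : I -> K)
    (w : I -> seq nat) (w0 : seq nat) :
  (forall t : nat -> K, \sum_(x <- s) a x * \prod_(i <- w x) t i = 0) ->
  \sum_(x <- s | perm_eq (w x) w0) a x = 0.
Proof.
(* [w0] is included so that letter counts below the bound [n] decide [perm_eq (w x) w0]. *)
move=> vanish; pose ws := flatten (w0 :: map w s).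
have [n lt_n] : exists n, forall i : nat, i \in ws -> (i < n)%N.
  by exists (\max_(i <- ws) i).+1 => i wi; rewrite ltnS leq_bigmax_seq.
have ws_w x (i : nat) : x \in s -> i \in w x -> i \in ws.
  by move=> sx wi; rewrite mem_cat; apply/orP; right; apply/flatten_mapP; exists x.
have ws_w0 (i : nat) : i \in w0 -> i \in ws by rewrite mem_cat => ->.
pose e x (i : nat) := count_mem i (w x).
transitivity
    (\sum_(x <- s | all (fun i => e x i == count_mem i w0) (iota 0 n)) a x).
  rewrite big_seq_cond [RHS]big_seq_cond; apply: eq_bigl => x.
  case: (boolP (x \in s)) => //= sx.
  apply/idP/allP => [/permP eq_w i _|eq_w]; first by rewrite /e eq_w.
  rewrite /perm_eq; apply/allP => i /=; rewrite mem_cat => wi; apply: eq_w.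
  rewrite mem_iota /= add0n; apply: lt_n.
  by case/orP: wi => [/(ws_w x)|/ws_w0]; first apply.
apply: multipoly_coef_eq0 => t.
rewrite -[RHS](vanish t) [LHS]big_seq [RHS]big_seq.
apply: eq_bigr => x sx; congr (_ * _).
have w_iota : {subset w x <= iota 0 n}.
  by move=> i wi; rewrite mem_iota /= add0n; apply/lt_n/(ws_w x).
rewrite /e; elim: (w x) w_iota => [|i u IHu] sub.
  by rewrite big_nil big1_seq // => j _; rewrite expr0.
rewrite big_cons -IHu; last by move=> j uj; apply: sub; rewrite inE uj orbT.
under eq_bigr do rewrite /= exprD.
rewrite big_split /= (bigD1_seq i) ?iota_uniq ?sub ?mem_head //= eqxx expr1.
by rewrite big1 ?mulr1 // => j /negPf; rewrite eq_sym => ->.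
Qed.

End InfiniteField.

(** * Subspaces and bases modulo a subspace *)

Section Subspaces.
Variables (K : nzRingType) (V : lmodType K).

Definition is_subspace (P : set V) : Prop :=
  P 0 /\ forall (k : K) a b, P a -> P b -> P (k *: a + b).

Section Closure.
Variables (P : set V) (subP : is_subspace P).

Lemma subspaceD a b : P a -> P b -> P (a + b).
Proof. by move=> Pa Pb; rewrite -[a]scale1r; apply: subP.2. Qed.

Lemma subspaceZ k a : P a -> P (k *: a).
Proof. by move=> Pa; rewrite -[_ *: _]addr0; apply: subP.2 => //; apply: subP.1. Qed.

Lemma subspaceN a : P a -> P (- a).
Proof. by rewrite -scaleN1r; apply: subspaceZ. Qed.

Lemma subspaceB a b : P a -> P b -> P (a - b).
Proof. by move=> Pa Pb; apply: subspaceD => //; apply: subspaceN. Qed.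

Lemma subspace_sum (I : eqType) (s : seq I) (F : I -> V) :
  (forall i, i \in s -> P (F i)) -> P (\sum_(i <- s) F i).
Proof.
by move=> PF; rewrite big_seq; apply: big_ind => //; [exact: subP.1 | exact: subspaceD].
Qed.

Lemma lin_span_min (S : set V) : S `<=` P -> lin_span S `<=` P.
Proof.
move=> SP _ [n [c [e [Se ->]]]]; apply: subspace_sum => i _.
exact/subspaceZ/SP/Se.
Qed.

Lemma subspace_sub_trans a b : P (a - b) -> P b -> P a.
Proof. by move=> Pab Pb; rewrite -[a](subrK b); apply: subspaceD. Qed.

End Closure.

Lemma lin_span_in (S : set V) : S `<=` lin_span S.
Proof.
by move=> v Sv; exists 1%N, (fun=> 1), (fun=> v); rewrite big_ord1 scale1r.
Qed.

Lemma lin_span_subspace (S : set V) : is_subspace (lin_span S).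
Proof.
split=> [|k _ _ [n1 [c1 [e1 [Se1 ->]]]] [n2 [c2 [e2 [Se2 ->]]]]].
  by exists 0%N, (fun=> 0), (fun=> 0); rewrite big_ord0; split=> // -[].
exists (n1 + n2)%N,
  (fun i => match fintype.split i with inl j => k * c1 j | inr j => c2 j end),
  (fun i => match fintype.split i with inl j => e1 j | inr j => e2 j end).
split=> [i|]; first by case: fintype.splitP.
rewrite big_split_ord scaler_sumr; congr (_ + _); apply: eq_bigr => i _.
  by rewrite (unsplitK (inl _ i)) scalerA.
by rewrite (unsplitK (inr _ i)).
Qed.

Lemma lin_span_mono (S T : set V) : S `<=` T -> lin_span S `<=` lin_span T.
Proof.
move=> ST; apply: lin_span_min (lin_span_subspace T) _ _ => v /ST.
exact: lin_span_in.
Qed.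

(** Serves to rewrite two combinations over a common list of indices, extending the coefficients by
    zero. *)
Lemma sum_restrict (I : eqType) (s r : seq I) (c : I -> K) (e : I -> V) :
  uniq s -> uniq r -> {subset r <= s} ->
  \sum_(i <- s) (if i \in r then c i else 0) *: e i = \sum_(i <- r) c i *: e i.
Proof.
move=> us ur rs; have r_filter : perm_eq r [seq i <- s | i \in r].
  apply: uniq_perm => //; first exact: filter_uniq.
  by move=> i; rewrite mem_filter; apply/esym/andb_idr/rs.
rewrite [RHS](perm_big _ r_filter) big_filter [RHS]big_mkcond.
apply: eq_bigr => i _.
by case: ifP; rewrite ?scale0r.
Qed.

(** Repeated indices are merged, which gives the duplicate-free form to which independence
    applies. *)
Lemma lin_span_modP (J : set V) (I : choiceType) (e : I -> V) (S : set I) v :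
  is_subspace J -> lin_span (J `|` e @` S) v ->
  exists (s : seq I) (c : I -> K),
    [/\ uniq s, forall i, i \in s -> S i & J (v - \sum_(i <- s) c i *: e i)].
Proof.
move=> subJ; move: v; apply: lin_span_min => [|v [Jv|[i Si <-]]].
- split.
    exists [::], (fun=> 0); split=> //; rewrite big_nil subr0; exact: subJ.1.
  move=> k a b [s1 [c1 [u1 S1 J1]]] [s2 [c2 [u2 S2 J2]]].
  exists (undup (s1 ++ s2)), (fun i => k * (if i \in s1 then c1 i else 0) +
    (if i \in s2 then c2 i else 0)); split; first exact: undup_uniq.
    by move=> i; rewrite mem_undup mem_cat => /orP[/S1|/S2].
  under eq_bigr do rewrite scalerDl -scalerA.
  rewrite big_split /= -scaler_sumr !sum_restrict ?undup_uniq //; first last.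
  + by move=> i s1i; rewrite mem_undup mem_cat s1i.
  + by move=> i s2i; rewrite mem_undup mem_cat s2i orbT.
  by rewrite opprD addrACA -scalerBr; apply: subJ.2.
- by exists [::], (fun=> 0); split=> //; rewrite big_nil subr0.
- exists [:: i], (fun=> 1); split=> // [j|]; first by rewrite inE => /eqP ->.
  by rewrite big_seq1 scale1r subrr; exact: subJ.1.
Qed.

Lemma is_basis_mod_span (J : set V) (I : choiceType) (e : I -> V) (S : set I) v :
  is_basis_mod J e S -> lin_span (J `|` e @` S) v.
Proof.
move=> [_ /(_ v)[s [c [Ss Jv]]]]; have subS := lin_span_subspace (J `|` e @` S).
apply: (subspace_sub_trans subS); first by apply: lin_span_in; left; exact: Jv.
apply: subspace_sum => // i si; apply: subspaceZ => //; apply: lin_span_in; right.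
by exists i => //; apply: Ss.
Qed.

(** The independence half of [is_basis_mod], kept apart because spanning and independence are first
    proved modulo different subspaces. *)
Definition free_mod (J : set V) (I : choiceType) (e : I -> V) (S : set I) : Prop :=
  forall (s : seq I) (c : I -> K), uniq s -> (forall i, i \in s -> S i) ->
  J (\sum_(i <- s) c i *: e i) -> forall i, i \in s -> c i = 0.

Lemma is_basis_modI (J : set V) (I : choiceType) (e : I -> V) (S : set I) :
  is_subspace J -> free_mod J e S -> (forall v, lin_span (J `|` e @` S) v) ->
  is_basis_mod J e S.
Proof.
move=> subJ freeS spanS; split=> // v.
by have [s [c []]] := lin_span_modP subJ (spanS v); exists s, c.
Qed.

(** Expand an element of [J'] modulo [J]: the combination obtained lies in [J'], so its coefficients
    vanish and the element was in [J]. *)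
Lemma span_free_eq (J J' : set V) (I : choiceType) (e : I -> V) (S : set I) :
  is_subspace J -> is_subspace J' -> J `<=` J' ->
  (forall v, lin_span (J `|` e @` S) v) -> free_mod J' e S -> J' = J.
Proof.
move=> subJ subJ' JJ' spanS freeS; apply/seteqP; split=> // v J'v.
have [s [c [us Ss Jv]]] := lin_span_modP subJ (spanS v).
have c0 : forall i, i \in s -> c i = 0.
  apply: freeS => //; rewrite -[X in J' X](subKr v).
  by apply: subspaceB => //; apply: JJ'.
by move: Jv; rewrite big1_seq ?subr0 // => i /c0 ->; rewrite scale0r.
Qed.

End Subspaces.

(** * Lie words *)

Section LieLemmas.
Variables (K : nzRingType) (L : lieAlgType K).
Implicit Types a b c : L.

Lemma lie0l b : lie 0 b = 0.
Proof. by rewrite -(scale0r (0 : L)) lieZl !scale0r. Qed.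

Lemma lie0r b : lie b 0 = 0.
Proof. by rewrite -(scale0r (0 : L)) lieZr !scale0r. Qed.

Lemma lieNr a b : lie a (- b) = - lie a b.
Proof. by rewrite -!scaleN1r lieZr. Qed.

Lemma lieC a b : lie a b = - lie b a.
Proof.
apply/eqP; rewrite -addr_eq0; apply/eqP.
by have := liexx (a + b); rewrite lieDl !lieDr !liexx add0r addr0.
Qed.

(** The Jacobi identity as a derivation rule: [c] moves past [b] at the cost of a term with the
    inner bracket of [b] and [c]. *)
Lemma lie_lie a b c : lie (lie a b) c = lie (lie a c) b + lie a (lie b c).
Proof.
rewrite [LHS]lieC -(addr0 (- _)) -(lie_jacobi a b c) addrC addrK addrC.
by rewrite [lie (lie a c) b]lieC (lieC a c) lieNr opprK.
Qed.

Lemma ideal_subspace (J : set L) : is_lie_ideal J -> is_subspace J.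
Proof. by case. Qed.

Lemma ideal_liel (J : set L) a b : is_lie_ideal J -> J a -> J (lie a b).
Proof. by move=> [_ _ lieJ] Ja; case: (lieJ a b Ja). Qed.

Lemma ideal_lier (J : set L) a b : is_lie_ideal J -> J b -> J (lie a b).
Proof. by move=> [_ _ lieJ] Jb; case: (lieJ b a Jb). Qed.

Lemma lin_span_lie (S T P : set L) : is_subspace P ->
  (forall a b, S a -> T b -> P (lie a b)) ->
  forall a b, lin_span S a -> lin_span T b -> P (lie a b).
Proof.
move=> subP PST a b Sa Tb; move: a Sa.
apply: lin_span_min => [|a Sa]; first split=> [|k a a' Pa Pa'].
- by rewrite lie0l; apply: subP.1.
- by rewrite lieDl lieZl; apply: subP.2.
move: b Tb; apply: lin_span_min => [|b Tb]; first split=> [|k b b' Pb Pb'].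
- by rewrite lie0r; apply: subP.1.
- by rewrite lieDr lieZr; apply: subP.2.
exact: PST.
Qed.

Lemma subspace_liel (P : set L) b : is_subspace P ->
  is_subspace [set a | P (lie a b)].
Proof.
by move=> [P0 PD]; split=> [|k a a' Pa Pa'] /=; rewrite ?lie0l // lieDl lieZl; apply: PD.
Qed.

Section Words.
Variable y : nat -> L.

Definition lword (u : L) (w : seq nat) : L := foldl (fun a i => lie a (y i)) u w.

Lemma lword_cat u w1 w2 : lword u (w1 ++ w2) = lword (lword u w1) w2.
Proof. exact: foldl_cat. Qed.

Lemma lword_rcons u w i : lword u (rcons w i) = lie (lword u w) (y i).
Proof. exact: foldl_rcons. Qed.

Lemma lword_linear w : linear (lword^~ w).
Proof. by elim: w => //= i w IHw k a b; rewrite lieDl lieZl IHw. Qed.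

Lemma lwordB w a b : lword (a - b) w = lword a w - lword b w.
Proof. by rewrite addrC -scaleN1r lword_linear scaleN1r addrC. Qed.

Variables (P : set L) (subP : is_subspace P).
Hypothesis P_y : forall u i, P u -> P (lie u (y i)).

Lemma lword_closed u w : P u -> P (lword u w).
Proof. by elim: w u => //= i w IHw u Pu; apply/IHw/P_y. Qed.

(** Exchanging two adjacent letters changes a word by the word in which their bracket replaces them.
    By [comm] this bracket puts the prefix into [P], and [P_y] lets the remaining letters follow. *)
Lemma lword_perm u w w' :
  (forall v i j, P (lie (lword u v) (lie (y i) (y j)))) ->
  perm_eq w w' -> P (lword u w - lword u w').
Proof.
move=> comm.
have swap1 i v s : P (lword u (rcons v i ++ s) - lword u (rcons (v ++ s) i)).
  elim: s v => [|j s IHs] v; first by rewrite !cats0 subrr; apply: subP.1.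
  rewrite -[X in P X](subrKA (lword u (rcons (rcons v j) i ++ s))).
  apply: subspaceD => //; last by rewrite -(cat_rcons j v s); apply: IHs.
  rewrite -cat_rcons !lword_cat -lwordB; apply: lword_closed.
  by rewrite !lword_rcons lie_lie addrC addKr.
have swap s1 s2 v : P (lword u (v ++ s1 ++ s2) - lword u (v ++ s2 ++ s1)).
  elim: s1 v => [|i s1 IHs] v; first by rewrite cats0 subrr; apply: subP.1.
  rewrite -[X in P X](subrKA (lword u (rcons v i ++ s2 ++ s1))).
  apply: subspaceD => //; first by rewrite -cat_rcons; apply: IHs.
  rewrite -(cat_rcons i s2 s1) (catA (rcons v i)) (catA v) -rcons_cat.
  by rewrite !(lword_cat _ _ s1) -lwordB; apply: lword_closed.
(* Exchanges of two blocks at the front of a word generate all permutations. *)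
move=> eq_ww'; pose Q x := P (lword u w - lword u x).
apply: (@catCA_perm_ind _ Q _ _ _ eq_ww') => [s1 s2 s3|]; last by rewrite /Q subrr; apply: subP.1.
rewrite /Q => Qs; rewrite -[X in P X](subrKA (lword u (s1 ++ s2 ++ s3))).
apply: subspaceD => //; rewrite !catA !(lword_cat _ _ s3) -lwordB.
by apply: lword_closed; apply: (swap _ _ [::]).
Qed.

End Words.
End LieLemmas.

(** * Homomorphisms of Lie algebras *)

Section LieHoms.
Variables (K : nzRingType) (L A C : lieAlgType K).

Section Hom.
Variables (phi : L -> A) (hom_phi : is_lie_hom phi).

Lemma lie_hom0 : phi 0 = 0.
Proof. by have := hom_phi.1 (-1) 0 0; rewrite scaler0 addr0 scaleN1r addNr. Qed.

Lemma lie_homD a b : phi (a + b) = phi a + phi b.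
Proof. by have := hom_phi.1 1 a b; rewrite !scale1r. Qed.

Lemma lie_homZ k a : phi (k *: a) = k *: phi a.
Proof. by have := hom_phi.1 k a 0; rewrite lie_hom0 !addr0. Qed.

Lemma lie_hom_sum (I : Type) (s : seq I) (P : pred I) (F : I -> L) :
  phi (\sum_(i <- s | P i) F i) = \sum_(i <- s | P i) phi (F i).
Proof. exact: (big_morph phi lie_homD lie_hom0). Qed.

Lemma lie_hom_lword (y : nat -> L) u w :
  phi (lword y u w) = lword (phi \o y) (phi u) w.
Proof. by elim: w u => //= i w IHw u; rewrite IHw hom_phi.2. Qed.

Lemma preimage_subspace (P : set A) : is_subspace P -> is_subspace (phi @^-1` P).
Proof.
move=> [P0 PD]; split=> [|k a b Pa Pb]; rewrite /preimage /= ?lie_hom0 //.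
by rewrite lie_homD lie_homZ; apply: PD.
Qed.

End Hom.

Lemma lie_hom_comp (phi : L -> A) (psi : A -> C) :
  is_lie_hom phi -> is_lie_hom psi -> is_lie_hom (psi \o phi).
Proof.
move=> hphi hpsi; split=> [k a b|a b] /=; last by rewrite hphi.2 hpsi.2.
by rewrite hphi.1 hpsi.1.
Qed.

End LieHoms.

Section FreeLieLemmas.
Variables (K : nzRingType) (X : Type).

Lemma free_lie_ind (P : set (free_lie K X)) : is_subspace P ->
  (forall x, P (fl_var K x)) -> (forall a b, P a -> P b -> P (lie a b)) ->
  forall v, P v.
Proof.
move=> subP Pvar Plie v; rewrite -(lie_class_repr v).
elim: (repr v) => [x||t Pt u Pu|k t Pt|t Pt u Pu]; first exact: (Pvar x).
- exact: subP.1.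
- by rewrite -fl_addE; apply: (subspaceD subP).
- by rewrite -fl_scaleE; apply: (subspaceZ subP).
- by rewrite -fl_lieE; apply: Plie.
Qed.

Lemma mon_eval_left_normed (m : lie_mon X) (y : nat -> X) (w : seq nat) :
  mon_eval K (left_normed m (map y w)) = lword (fun i => fl_var K (y i)) (mon_eval K m) w.
Proof. by elim: w m => //= i w IHw m; rewrite IHw. Qed.

Lemma mon_length_gt0 (m : lie_mon X) : (0 < mon_length m)%N.
Proof. by elim: m => //= m1 IH1 m2 _; rewrite addn_gt0 IH1. Qed.

Lemma identities_ideal (A : lieAlgType K) : is_lie_ideal (@identities K A X).
Proof.
split=> [phi hphi|k a b Ia Ib phi hphi|a b Ia]; first exact: (lie_hom0 hphi).
  by rewrite hphi.1 Ia // Ib // scaler0 addr0.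
by split=> phi hphi; rewrite hphi.2 Ia // ?lie0l ?lie0r.
Qed.

End FreeLieLemmas.

Lemma mon_eval_map (K : nzRingType) (X Y : Type) (f : X -> Y) (m : lie_mon X) :
  mon_eval K (mon_map f m) = fl_lift (fun x => fl_var K (f x)) (mon_eval K m).
Proof.
elim: m => /= [x|m1 IH1 m2 IH2]; first by rewrite fl_lift_var.
by rewrite (fl_lift_hom _).2 IH1 IH2.
Qed.

Lemma mon_mapK (X Y : Type) (f : X -> Y) (g : Y -> X) :
  cancel f g -> cancel (mon_map f) (mon_map g).
Proof. by move=> fK; elim=> /= [x|m1 -> m2 ->]; rewrite ?fK. Qed.

(** * UT_2 and UT_3 in coordinates *)

Section SmallTriangular.
Variable K : comNzRingType.

Lemma UT_entry_sum (n : nat) (I : Type) (s : seq I) (P : pred I) (c : I -> K)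
    (F : I -> UT K n) (i j : 'I_n) :
  val (\sum_(x <- s | P x) c x *: F x) i j = \sum_(x <- s | P x) c x * val (F x) i j.
Proof.
have entry0 : val (0 : UT K n) i j = 0 by rewrite [LHS]mxE.
have entryD (A B : UT K n) : val (A + B) i j = val A i j + val B i j.
  by rewrite [LHS]mxE.
rewrite (big_morph (fun A : UT K n => val A i j) entryD entry0).
by apply: eq_bigr => x _; rewrite [LHS]mxE.
Qed.

Definition ut2_mx (a b p : K) : 'M[K]_2 :=
  \matrix_(i, j) match nat_of_ord i, nat_of_ord j with
                 | 0, 0 => a | 1, 1 => b | 0, 1 => p | _, _ => 0
                 end.

Fact ut2_mx_upper a b p : ut2_mx a b p \in @upper_tri K 2.
Proof. by apply/upper_triP => -[[|[|//]] ?] [[|[|//]] ?] //= _; rewrite mxE. Qed.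

Definition ut2 a b p : UT K 2 := exist (fun A => A \in @upper_tri K 2) _ (ut2_mx_upper a b p).

Definition ut3_mx (a b c p q r : K) : 'M[K]_3 :=
  \matrix_(i, j) match nat_of_ord i, nat_of_ord j with
                 | 0, 0 => a | 1, 1 => b | 2, 2 => c
                 | 0, 1 => p | 1, 2 => q | 0, 2 => r | _, _ => 0
                 end.

Fact ut3_mx_upper a b c p q r : ut3_mx a b c p q r \in @upper_tri K 3.
Proof.
by apply/upper_triP => -[[|[|[|//]]] ?] [[|[|[|//]]] ?] //= _; rewrite mxE.
Qed.

(* Diagonal [a, b, c]; then the entries e_12, e_23, e_13. *)
Definition ut3 a b c p q r : UT K 3 :=
  exist (fun A => A \in @upper_tri K 3) _ (ut3_mx_upper a b c p q r).

Lemma ut2P (A : UT K 2) : exists a b p, A = ut2 a b p.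
Proof.
exists (val A ord0 ord0), (val A ord_max ord_max), (val A ord0 ord_max).
apply/val_inj/matrixP => i j; rewrite mxE.
have [ji|] := ltnP j i; first (have /upper_triP -> // := valP A; move: ji).
  by case: i j => [[|[|//]] ?] [[|[|//]] ?].
case: i j => [[|[|//]] ?] [[|[|//]] ?] //= _;
  by congr (val A _ _); apply/val_inj.
Qed.

Lemma ut3P (A : UT K 3) : exists a b c p q r, A = ut3 a b c p q r.
Proof.
pose o1 : 'I_3 := Ordinal (isT : 1 < 3)%N.
exists (val A ord0 ord0), (val A o1 o1), (val A ord_max ord_max),
  (val A ord0 o1), (val A o1 ord_max), (val A ord0 ord_max).
apply/val_inj/matrixP => i j; rewrite mxE.
have [ji|] := ltnP j i; first (have /upper_triP -> // := valP A; move: ji).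
  by case: i j => [[|[|[|//]]] ?] [[|[|[|//]]] ?].
case: i j => [[|[|[|//]]] ?] [[|[|[|//]]] ?] //= _;
  by congr (val A _ _); apply/val_inj.
Qed.

Lemma ut2_lie a b p a' b' p' :
  lie (ut2 a b p) (ut2 a' b' p') = ut2 0 0 (a * p' + p * b' - a' * p - p' * b).
Proof.
apply/val_inj/matrixP => i j; rewrite [LHS]mxE !mxE !big_ord_recl !big_ord0 !mxE.
by case: i j => [[|[|//]] ?] [[|[|//]] ?] /=; ring.
Qed.

Lemma ut3_lie a b c p q r a' b' c' p' q' r' :
  lie (ut3 a b c p q r) (ut3 a' b' c' p' q' r') =
  ut3 0 0 0 (a * p' + p * b' - a' * p - p' * b) (b * q' + q * c' - b' * q - q' * c)
    (a * r' + p * q' + r * c' - a' * r - p' * q - r' * c).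
Proof.
apply/val_inj/matrixP => i j; rewrite [LHS]mxE !mxE !big_ord_recl !big_ord0 !mxE.
by case: i j => [[|[|[|//]]] ?] [[|[|[|//]]] ?] /=; ring.
Qed.

Lemma ut3_linear k a b c p q r a' b' c' p' q' r' :
  k *: ut3 a b c p q r + ut3 a' b' c' p' q' r' =
  ut3 (k * a + a') (k * b + b') (k * c + c') (k * p + p') (k * q + q') (k * r + r').
Proof.
apply/val_inj/matrixP => i j; rewrite [LHS]mxE !mxE.
by case: i j => [[|[|[|//]]] ?] [[|[|[|//]]] ?] /=; ring.
Qed.

Lemma ut3_0 : ut3 0 0 0 0 0 0 = 0.
Proof.
apply/val_inj/matrixP => i j; rewrite !mxE.
by case: i j => [[|[|[|//]]] ?] [[|[|[|//]]] ?].
Qed.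

Lemma ut2_0 : ut2 0 0 0 = 0.
Proof.
by apply/val_inj/matrixP => i j; rewrite !mxE; case: i j => [[|[|//]] ?] [[|[|//]] ?].
Qed.

End SmallTriangular.

(** * The identities of UT_2 *)

Section WordLinearity.
Variables (K : nzRingType) (L : lieAlgType K) (y : nat -> L).

Lemma lword0 w : lword y 0 w = 0.
Proof. by have := lwordB y w 0 0; rewrite !subrr. Qed.

Lemma lwordN u w : lword y (- u) w = - lword y u w.
Proof. by rewrite -[- u]sub0r lwordB lword0 sub0r. Qed.

(** The two factors are immaterial: to be a commutator is all that the metabelian law asks of such a
    word. *)
Lemma lword_lie_is_lie u v w : exists a b, lword y (lie u v) w = lie a b.
Proof.
elim/last_ind: w => [|w i _]; first by exists u, v.
by exists (lword y (lie u v) w), (y i); rewrite lword_rcons.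
Qed.

(** Brings a later letter [i] into second place, where a basis commutator needs its smallest
    letter. *)
Lemma lword_lie_swap u i j w :
  lword y (lie u (y j)) (i :: w) = 
  lword y (lie u (y i)) (j :: w) + lword y (lie u (lie (y j) (y i))) w.
Proof. by rewrite /= lie_lie -[X in lword y (X + _)]scale1r lword_linear scale1r. Qed.

End WordLinearity.

Definition met_mon (i j : nat) (w : seq nat) : lie_mon nat :=
  left_normed (MLie (MVar i) (MVar j)) w.

(** The classical basis of the free metabelian Lie algebra, as formal monomials. *)
Definition met_mons : set (lie_mon nat) :=
  [set m | (exists i, m = MVar i) \/
     exists i j w, [/\ (j < i)%N, sorted leq (j :: w) & m = met_mon i j w]].

Lemma mon_eval_met_mon (K : nzRingType) i j w :
  mon_eval K (met_mon i j w) =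
  lword (@fl_var K nat) (lie (fl_var K i) (fl_var K j)) w.
Proof. by rewrite /met_mon -[w in LHS]map_id mon_eval_left_normed. Qed.

(** * Spanning modulo the metabelian law *)

Section MetabelianSpan.
Variables (K : nzRingType) (J : set (free_lie K nat)).
Hypothesis idealJ : is_lie_ideal J.
Hypothesis metabelian : forall a b c d, J (lie (lie a b) (lie c d)).

Let subJ := ideal_subspace idealJ.
Let y i := fl_var K (i : nat).
Let Q := lin_span (J `|` @mon_eval K nat @` met_mons).
Let subQ : is_subspace Q := lin_span_subspace _.
Let Q_J v : J v -> Q v. Proof. by move=> Jv; apply: lin_span_in; left. Qed.

(** Every prefix of the word is a commutator, so by the metabelian law its bracket with
    [lie (y i) (y j)] lies in [J]. *)
Let lword_sort u v w w' : perm_eq w w' -> 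
  Q (lword y (lie u v) w') -> Q (lword y (lie u v) w).
Proof.
move=> eq_ww'; apply: (subspace_sub_trans subQ); apply: Q_J.
apply: lword_perm => // [a i|s i j]; first exact: ideal_liel.
by have [a [b ->]] := lword_lie_is_lie y u v s.
Qed.

Lemma met_word_min i j w : (j < i)%N -> all (leq j) w -> Q (lword y (lie (y i) (y j)) w).
Proof.
move=> ji jw; apply: (lword_sort (w' := sort leq w)); first by rewrite perm_sym perm_sort.
apply: lin_span_in; right; exists (met_mon i j (sort leq w)).
  right; exists i, j, (sort leq w); split=> //=.
  by rewrite path_min_sorted ?all_sort // sort_sorted //; apply: leq_total.
exact: mon_eval_met_mon.
Qed.

(** Antisymmetry gives [j < i]. If the least letter [k] of [w] is below [j], the Jacobi identity
    produces two words, starting with [lie (y i) (y k)] and, up to sign, [lie (y j) (y k)]. Both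
    have the least letter in second place. *)
Lemma met_word_span i j w : Q (lword y (lie (y i) (y j)) w).
Proof.
wlog ji : i j / (j < i)%N => [wlog_ji|].
  have [/wlog_ji //|ij|<-] := ltngtP j i; last by rewrite liexx lword0; apply: subQ.1.
  by rewrite lieC lwordN; apply/(subspaceN subQ)/wlog_ji.
case def_v: (sort leq w) => [|k v].
  by apply: met_word_min => //; rewrite -(all_sort _ leq) def_v.
have perm_w : perm_eq w (k :: v) by rewrite -def_v perm_sym perm_sort.
have k_min : all (leq k) v.
  have := sort_sorted leq_total w; rewrite def_v /=.
  by move=> /(order_path_min leq_trans).
have [jk|kj] := leqP j k.
  apply: met_word_min => //; rewrite (perm_all _ perm_w) /= jk.
  by apply: sub_all k_min => a; apply: leq_trans.
apply: (lword_sort perm_w); rewrite lword_lie_swap; apply: (subspaceD subQ).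
  by apply: met_word_min; rewrite /= ?(ltnW kj) // (ltn_trans kj).
rewrite lieC lwordN; apply: (subspaceN subQ).
have := @met_word_min j k (i :: v) kj.
by rewrite /= (ltnW (ltn_trans kj ji)) => /(_ k_min).
Qed.

Lemma met_mons_span v : lin_span (J `|` @mon_eval K nat @` met_mons) v.
Proof.
(* This span is closed under brackets: a bracket with a variable lengthens a word up to sign, and
   the bracket of two commutator words lies in [J]. *)
pose S := J `|` range y `|` [set u | exists i j w, u = lword y (lie (y i) (y j)) w].
have subS := lin_span_subspace S.
have S_J u : J u -> lin_span S u by move=> Ju; apply: lin_span_in; left; left.
have S_w i j w : lin_span S (lword y (lie (y i) (y j)) w).
  by apply: lin_span_in; right; exists i, j, w.
suff : lin_span S v.
  move: v; apply: lin_span_min => // v [[Jv|[i _ <-]]|[i [j [w ->]]]].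
  - exact: Q_J.
  - by apply: lin_span_in; right; exists (MVar i) => //; left; exists i.
  - exact: met_word_span.
move: v; apply: (free_lie_ind subS) => [i|].
  by apply: lin_span_in; left; right; exists i.
apply: (lin_span_lie subS) => a b [[Ja|[i _ <-]]|[i [j [w ->]]]].
- by move=> _; exact: S_J (ideal_liel _ idealJ Ja).
- move=> [[Jb|[j _ <-]]|[j [k [w ->]]]]; first exact: S_J (ideal_lier _ idealJ Jb).
    exact: (S_w _ _ [::]).
  by rewrite lieC -lword_rcons; apply: (subspaceN subS); apply: S_w.
- move=> [[Jb|[k _ <-]]|[k [l [w' ->]]]]; first exact: S_J (ideal_lier _ idealJ Jb).
    by rewrite -lword_rcons; apply: S_w.
  have [c [d ->]] := lword_lie_is_lie y (y i) (y j) w.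
  by have [c' [d' ->]] := lword_lie_is_lie y (y k) (y l) w'; apply: S_J.
Qed.

End MetabelianSpan.

(** * Evaluations in [UT K 2] and the basis of its relatively free algebra *)

Section UT2Evaluations.
Variables (K : fieldType).

(** On multiples of [e_12], bracketing with [t_i e_22 + q_i e_12] is multiplication by [t_i]. *)
Lemma ut2_lword_comm (t q : nat -> K) p w :
  lword (fun i => ut2 0 (t i) (q i)) (ut2 0 0 p) w =
  ut2 0 0 (p * \prod_(i <- w) t i).
Proof.
elim: w p => [|i w IHw] p /=; first by rewrite big_nil mulr1.
by rewrite ut2_lie -[RHS]/(ut2 _ _ _) big_cons mulrA -IHw; congr (lword _ (ut2 _ _ _)); ring.
Qed.

Lemma ut2_eval_met_mon (t q : nat -> K) i j w :
  fl_lift (fun i => ut2 0 (t i) (q i)) (mon_eval K (met_mon i j w)) =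
  ut2 0 0 ((q i * t j - q j * t i) * \prod_(k <- w) t k).
Proof.
rewrite mon_eval_met_mon (lie_hom_lword (fl_lift_hom _)) (fl_lift_hom _).2.
rewrite !fl_lift_var ut2_lie -(ut2_lword_comm t q).
have -> : (fl_lift (fun i => ut2 0 (t i) (q i)) \o @fl_var K nat) =
  (fun i => ut2 0 (t i) (q i)) by apply: funext => k /=; rewrite fl_lift_var.
by congr (lword _ (ut2 _ _ _)); ring.
Qed.

(** All variables go to multiples of the single matrix [e_22], so every bracket vanishes and only
    the variable [k] survives. *)
Lemma ut2_eval_linear_part (k : nat) (m : lie_mon nat) :
  fl_lift (fun i => ut2 0 ((i == k)%:R : K) 0) (mon_eval K m) =
  ut2 0 (m == MVar k)%:R 0.
Proof.
elim: m => [i|m1 IH1 m2 IH2] /=.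
  rewrite fl_lift_var; congr (ut2 _ ((nat_of_bool _)%:R) _); apply/idP/idP => [/eqP ->//|].
  by move=> /eqP[->].
rewrite (fl_lift_hom _).2 IH1 IH2 ut2_lie.
have -> : MLie m1 m2 == MVar k = false by apply/eqP.
by congr (ut2 _ _ _); ring.
Qed.

(** A commutator has zero diagonal in [UT K 2], while the evaluation that sends [y_k] to [e_22] and
    the other variables to 0 reads off the coefficient of [MVar k] on the diagonal. *)
Lemma identity_linear_part (s : seq (lie_mon nat)) (c : lie_mon nat -> K) a b k :
  uniq s -> identities (UT K 2) (lie a b - \sum_(m <- s) c m *: mon_eval K m) ->
  MVar k \in s -> c (MVar k) = 0.
Proof.
move=> us Id_v sk; pose h := fl_lift (fun i => ut2 0 ((i == k)%:R : K) 0).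
have hom_h : is_lie_hom h := fl_lift_hom _.
have h_mon m : h (mon_eval K m) = ut2 0 (m == MVar k)%:R 0.
  exact: ut2_eval_linear_part.
have entry_lie : val (h (lie a b)) ord_max ord_max = 0.
  rewrite hom_h.2; have [? [? [? ->]]] := ut2P (h a).
  by have [? [? [? ->]]] := ut2P (h b); rewrite ut2_lie mxE.
have := Id_v h hom_h; rewrite (lie_homD hom_h) -scaleN1r (lie_homZ hom_h) scaleN1r.
move=> /subr0_eq /(congr1 (fun A : UT K 2 => val A ord_max ord_max)) /=.
rewrite [LHS]entry_lie (lie_hom_sum hom_h).
under eq_bigr do rewrite (lie_homZ hom_h).
rewrite UT_entry_sum (bigD1_seq _ sk us) h_mon mxE /= eqxx mulr1.
rewrite big1 ?addr0 => [->//|m /negPf m_neq].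
by rewrite h_mon m_neq mxE /= mulr0.
Qed.

Lemma identity_entry (h : free_lie K nat -> UT K 2) (s : seq (lie_mon nat))
    (c : lie_mon nat -> K) i j :
  is_lie_hom h -> identities (UT K 2) (\sum_(m <- s) c m *: mon_eval K m) ->
  \sum_(m <- s) c m * val (h (mon_eval K m)) i j = 0.
Proof.
move=> hom_h /(_ h hom_h); rewrite (lie_hom_sum hom_h).
under eq_bigr do rewrite (lie_homZ hom_h).
by move=> /(congr1 (fun A : UT K 2 => val A i j)) /=; rewrite UT_entry_sum mxE.
Qed.

Hypothesis K_infinite : infinite_set [set: K].

(** The variables are removed by their linear parts. For a commutator [m0] with first letter [p], an
    evaluation in which only [y_p] has a nonzero [e_12] entry turns the relation into a polynomial
    identity, and [m0] alone contributes to its own monomial. *)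
Lemma met_mons_free :
  free_mod (@identities K (UT K 2) nat) (@mon_eval K nat) met_mons.
Proof.
move=> s c us Ss Id_s.
have c_var k : MVar k \in s -> c (MVar k) = 0.
  move=> sk; apply: (@identity_linear_part s c 0 0 k us) => //.
  rewrite lie0l sub0r; apply: (subspaceN (ideal_subspace (identities_ideal _ _))).
  exact: Id_s.
(* Chooses a reading [(i, j, w)] of each basis commutator; its value on other monomials is a
   dummy. *)
have /choice[dec dec_met] (m : lie_mon nat) : exists d : nat * nat * seq nat,
    met_mons m -> (exists k, m = MVar k) \/
    [/\ (d.1.2 < d.1.1)%N, sorted leq (d.1.2 :: d.2) & m = met_mon d.1.1 d.1.2 d.2].
  have [[[k ->]|[i [j [w [ji jw ->]]]]]|not_met] := pselect (met_mons m).
  - by exists (0%N, 0%N, [::]) => _; left; exists k.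
  - by exists (i, j, w) => _; right.
  - by exists (0%N, 0%N, [::]).
have dec_s m : m \in s -> c m = 0 \/ let: (i, j, w) := dec m in
    [/\ (j < i)%N, sorted leq (j :: w) & m = met_mon i j w].
  move=> sm; have [[k def_m]|] := dec_met m (Ss m sm); last first.
    by case: (dec m) => [[i j] w]; right.
  by left; rewrite def_m; apply: c_var; rewrite -def_m.
move=> m0 sm0; have [//|] := dec_s m0 sm0.
case def_d0: (dec m0) => [[p j0] w0] [j0p jw0 def_m0].
(* At [y_k = t_k e_22 + delta_kp e_12], [y_i, y_j, w] contributes the word
   [j :: w] if [i = p] and [i :: w] if [j = p]; only the former has a letter
   smaller than [p]. *)
pose a m := let: (i, j, w) := dec m in c m * ((i == p)%:R - (j == p)%:R).
pose wd m := let: (i, j, w) := dec m in (if i == p then j else i) :: w.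
have /(word_poly_coef_eq0 K_infinite (j0 :: w0)) :
    forall t : nat -> K, \sum_(m <- s) a m * \prod_(i <- wd m) t i = 0.
  move=> t; pose h := fl_lift (fun i => ut2 0 (t i) ((i == p)%:R : K)).
  have h_mon i j w : h (mon_eval K (met_mon i j w)) = _ := ut2_eval_met_mon _ _ i j w.
  rewrite -[RHS](identity_entry ord0 ord_max (fl_lift_hom _ : is_lie_hom h) Id_s).
  rewrite [LHS]big_seq [RHS]big_seq; apply: eq_bigr => m sm.
  move: (dec_s m sm); rewrite /a /wd; case: (dec m) => [[i j] w].
  move=> [->|[ji _ ->]]; first by rewrite !mul0r.
  rewrite h_mon mxE /= big_cons.
  case: eqP ji => [-> ji|_ ji]; first by rewrite (ltn_eqF ji) mulr0n mulr1n; ring.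
  by rewrite mulr0n; ring.
rewrite big_mkcond (bigD1_seq _ sm0 us) /= {1}/wd {1}/a def_d0 eqxx perm_refl.
rewrite (ltn_eqF j0p) subr0 mulr1 big1_seq ?addr0 // => m /andP[m_neq sm].
case: ifP => //; move: (dec_s m sm); rewrite /a /wd; case: (dec m) => [[i j] w].
move=> [->|[ji jw def_m]]; first by rewrite mul0r.
case: eqP def_m => [-> def_m perm_w|_ _ perm_w].
  case/eqP: m_neq; rewrite def_m def_m0.
  by case: (sorted_eq leq_trans anti_leq jw jw0 perm_w) => -> ->.
case: eqP => [def_j|_]; last by rewrite subr0 mulr0.
have : j0 \in i :: w by rewrite (perm_mem perm_w) mem_head.
rewrite inE => /predU1P[j0i|wj0].
  by move: j0p; rewrite j0i -def_j ltnNge (ltnW ji).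
have /allP/(_ j0 wj0) := order_path_min leq_trans jw.
by rewrite def_j leqNgt j0p.
Qed.

Lemma ut2_metabelian a b c d : identities (UT K 2) (lie (lie a b) (lie c d) : free_lie K nat).
Proof.
move=> h hom_h; rewrite !hom_h.2; have [? [? [? ->]]] := ut2P (h a).
have [? [? [? ->]]] := ut2P (h b); have [? [? [? ->]]] := ut2P (h c).
have [? [? [? ->]]] := ut2P (h d).
by rewrite !ut2_lie -ut2_0; congr (ut2 _ _ _); ring.
Qed.

Lemma met_mons_basis :
  is_basis_mod (@identities K (UT K 2) nat) (@mon_eval K nat) met_mons.
Proof.
apply: is_basis_modI; [exact/ideal_subspace/identities_ideal|exact: met_mons_free|].
by apply: met_mons_span => *; [exact: identities_ideal|exact: ut2_metabelian].
Qed.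

(** [J] may not consist of identities, so the comparison of spanning and freeness is made with the
    intersection of [J] and the identities. This still contains the metabelian law, hence is spanned
    against by [met_mons]. *)
Lemma identities_UT2_min (J : set (free_lie K nat)) : is_lie_ideal J ->
  (forall a b c d, J (lie (lie a b) (lie c d))) -> @identities K (UT K 2) nat `<=` J.
Proof.
move=> idealJ metJ; pose Id := @identities K (UT K 2) nat.
have idealI : is_lie_ideal (J `&` Id).
  have [J0 JD Jlie] := idealJ; have [I0 ID Ilie] := @identities_ideal K nat (UT K 2).
  split=> [|k a b [Ja Ia] [Jb Ib]|a b [Ja Ia]]; first by split.
    by split; [apply: JD|apply: ID].
  by have [? ?] := Jlie a b Ja; have [? ?] := Ilie a b Ia.
suff IdE : Id = J `&` Id by rewrite -/Id IdE => v [].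
apply: (span_free_eq (e := @mon_eval K nat) (S := met_mons)) met_mons_free.
- exact: ideal_subspace.
- exact/ideal_subspace/identities_ideal.
- by move=> v [].
- by apply: met_mons_span => // a b c d; split; [exact: metJ|exact: ut2_metabelian].
Qed.

End UT2Evaluations.

(** * Graded homomorphisms and T_G-ideals *)

Section GradedLemmas.
Variables (K : nzRingType) (G : groupType).
Notation L := (graded_free_lie K G).

Lemma free_comp_subspace d : is_subspace (@free_comp K G d).
Proof. exact: lin_span_subspace. Qed.

Lemma free_comp_var (x : nat * G) : @free_comp K G x.2 (fl_var K x).
Proof. by apply: lin_span_in; exists (MVar x). Qed.

Lemma free_comp_lie d d' (a b : L) :
  free_comp d a -> free_comp d' b -> free_comp (d * d')%g (lie a b).
Proof.
apply: lin_span_lie => [|_ _ [m dm <-] [m' dm' <-]]; first exact: free_comp_subspace.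
by apply: lin_span_in; exists (MLie m m') => //=; rewrite dm dm'.
Qed.

Lemma graded_lift (A : lieAlgType K) (Ac : G -> set A) (f : nat * G -> A) :
  (forall d, is_subspace (Ac d)) ->
  (forall d d' a b, Ac d a -> Ac d' b -> Ac (d * d')%g (lie a b)) ->
  (forall x, Ac x.2 (f x)) -> is_graded_hom (@free_comp K G) Ac (fl_lift f).
Proof.
move=> subA lieA Af; split=> [|d]; first exact: fl_lift_hom.
apply: (lin_span_min (preimage_subspace (fl_lift_hom f) (subA d))) => _ [m <- <-].
rewrite /preimage /=; elim: m => [x|m1 IH1 m2 IH2] /=; first by rewrite fl_lift_var.
by rewrite (fl_lift_hom f).2; apply: lieA.
Qed.

(** Graded endomorphisms are substitutions of homogeneous elements for variables of the same
    degree. *)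
Lemma TG_ideal_subst (J : set L) (f : nat * G -> L) v :
  is_TG_ideal J -> (forall x, free_comp x.2 (f x)) -> J v -> J (fl_lift f v).
Proof.
move=> [_ endJ] fc; apply: endJ; apply: graded_lift => // [d|d d' a b].
  exact: free_comp_subspace.
exact: free_comp_lie.
Qed.

Lemma smallest_TG_ideal (S : set L) : is_TG_ideal (smallest (@is_TG_ideal K G) S).
Proof.
split; first split=> [J [[[J0 _ _] _] _]//|k a b Sa Sb J JS|a b Sa].
- by have [[[_ JD _] _] _] := JS; apply: JD; [apply: Sa|apply: Sb].
- by split=> J JS; have [[[_ _ Jlie] _] _] := JS; case: (Jlie a b (Sa J JS)).
- by move=> phi hphi a Sa J JS; have [[_ endJ] _] := JS; apply: endJ => //; apply: Sa.
Qed.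

Lemma graded_identities_TG_ideal (A : lieAlgType K) (Ac : G -> set A) :
  is_TG_ideal (@graded_identities K G A Ac).
Proof.
split; first split=> [phi [hphi _]|k a b Ia Ib phi hphi|a b Ia].
- exact: lie_hom0 hphi.
- by rewrite hphi.1.1 Ia // Ib // scaler0 addr0.
- by split=> phi hphi; rewrite hphi.1.2 Ia // ?lie0l ?lie0r.
move=> phi [hphi phi_gr] a Ia psi [hpsi psi_gr]; apply: (Ia (psi \o phi)).
by split=> [|d v /phi_gr/psi_gr//]; apply: lie_hom_comp.
Qed.

End GradedLemmas.

(** * Homogeneous components of the grading on [UT K 3] *)

Section GammaComponents.
Variables (K : comNzRingType) (G : groupType) (g : G).
Hypothesis g_neq1 : g <> 1%g.

Let o1 : 'I_3 := Ordinal (isT : 1 < 3)%N.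

Let ord3P (i : 'I_3) : [\/ i = ord0, i = o1 | i = ord_max].
Proof.
case: i => [[|[|[|//]]] lti];
  [apply: Or31|apply: Or32|apply: Or33]; exact: val_inj.
Qed.

(** With [h = 1], the diagonal and [e_23] have degree 1, and [e_12] and [e_13] have degree [g]. The
    two implications describe all components at once: both are active, and the component is zero,
    when [d] is neither 1 nor [g]. *)
Lemma GammaP d (A : UT K 3) :
  Gamma K g 1%g d A <-> exists a b c p q r, [/\ A = ut3 a b c p q r,
    d <> 1%g -> [/\ a = 0, b = 0, c = 0 & q = 0] & d <> g -> p = 0 /\ r = 0].
Proof.
split.
  pose P := [set A | exists a b c p q r : K, [/\ A = ut3 a b c p q r,
    d <> 1%g -> [/\ a = 0, b = 0, c = 0 & q = 0] & d <> g -> p = 0 /\ r = 0]].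
  have subP : is_subspace P.
    split=> [|k _ _ [a [b [c [p [q [r [-> h1 hg]]]]]]]
      [a' [b' [c' [p' [q' [r' [-> h1' hg']]]]]]]].
      by exists 0, 0, 0, 0, 0, 0; rewrite ut3_0.
    rewrite ut3_linear; do 6!eexists; split; first reflexivity.
      by move=> d1; have [-> -> -> ->] := h1 d1; have [-> -> -> ->] := h1' d1;
        rewrite !mulr0 !addr0.
    by move=> dg; have [-> ->] := hg dg; have [-> ->] := hg' dg; rewrite !mulr0 !addr0.
  apply: (lin_span_min subP) => {}A [i [j [ij A_ij deg_ij]]].
  have [a [b [c [p [q [r def_A]]]]]] := ut3P A.
  have ent k l : ut3_mx a b c p q r k l = (delta_mx i j : 'M_3) k l.
    by rewrite -A_ij def_A.
  rewrite def_A; exists a, b, c, p, q, r; move: (ent ord0 ord0) (ent o1 o1) (ent ord_max ord_max)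
    (ent ord0 o1) (ent o1 ord_max) (ent ord0 ord_max) ij deg_ij; rewrite !mxE /=.
  by have [->|->|->] := ord3P i; have [->|->|->] := ord3P j; rewrite /Gamma_deg //= ?mulg1;
    move=> -> -> -> -> -> -> // _ <-.
move=> [a [b [c [p [q [r [-> h1 hg]]]]]]].
have subG : is_subspace (Gamma K g 1%g d) by apply: lin_span_subspace.
have unitG (i j : 'I_3) (B : UT K 3) : (i <= j)%N -> val B = delta_mx i j ->
    Gamma_deg g 1%g i j = d -> Gamma K g 1%g d B.
  by move=> ij B_ij dB; apply: lin_span_in; exists i, j.
have [d1|dn1] := pselect (d = 1%g).
  have [|-> ->] := hg; first by rewrite d1 => /esym.
  have -> : ut3 a b c 0 q 0 = a *: ut3 1 0 0 0 0 0 + (b *: ut3 0 1 0 0 0 0 +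
      (c *: ut3 0 0 1 0 0 0 + (q *: ut3 0 0 0 0 1 0 + 0))).
    by rewrite -ut3_0 !ut3_linear; congr (ut3 _ _ _ _ _ _); ring.
  apply: subG.2; last apply: subG.2; last apply: subG.2; last apply: subG.2; last exact: subG.1.
  - apply: (unitG ord0 ord0) => //=; apply/matrixP => i j; rewrite !mxE.
    by have [->|->|->] := ord3P i; have [->|->|->] := ord3P j.
  - apply: (unitG o1 o1) => //=; apply/matrixP => i j; rewrite !mxE.
    by have [->|->|->] := ord3P i; have [->|->|->] := ord3P j.
  - apply: (unitG ord_max ord_max) => //=; apply/matrixP => i j; rewrite !mxE.
    by have [->|->|->] := ord3P i; have [->|->|->] := ord3P j.
  - apply: (unitG o1 ord_max) => //=; apply/matrixP => i j; rewrite !mxE.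
    by have [->|->|->] := ord3P i; have [->|->|->] := ord3P j.
have [-> -> -> ->] := h1 dn1.
have [dg|dng] := pselect (d = g); last first.
  by have [-> ->] := hg dng; rewrite ut3_0; exact: subG.1.
have -> : ut3 0 0 0 p 0 r = p *: ut3 0 0 0 1 0 0 + (r *: ut3 0 0 0 0 0 1 + 0).
  by rewrite -ut3_0 !ut3_linear; congr (ut3 _ _ _ _ _ _); ring.
apply: subG.2; last apply: subG.2; last exact: subG.1.
- apply: (unitG ord0 o1) => //=; apply/matrixP => i j; rewrite !mxE.
  by have [->|->|->] := ord3P i; have [->|->|->] := ord3P j.
- apply: (unitG ord0 ord_max) => //=; last by rewrite /Gamma_deg /= mulg1.
  apply/matrixP => i j; rewrite !mxE.
  by have [->|->|->] := ord3P i; have [->|->|->] := ord3P j.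
Qed.

Lemma Gamma1 a b c q : Gamma K g 1%g 1%g (ut3 a b c 0 q 0).
Proof. by apply/GammaP; exists a, b, c, 0, q, 0; split. Qed.

Lemma Gammag p r : Gamma K g 1%g g (ut3 0 0 0 p 0 r).
Proof. by apply/GammaP; exists 0, 0, 0, p, 0, r; split. Qed.

Lemma Gamma1P A : Gamma K g 1%g 1%g A -> exists a b c q, A = ut3 a b c 0 q 0.
Proof.
move=> /GammaP[a [b [c [p [q [r [-> _ hg]]]]]]]; have [|-> ->] := hg; first exact: nesym.
by exists a, b, c, q.
Qed.

Lemma GammagP A : Gamma K g 1%g g A -> exists p r, A = ut3 0 0 0 p 0 r.
Proof.
by move=> /GammaP[a [b [c [p [q [r [-> /(_ g_neq1)[-> -> -> ->] _]]]]]]]; exists p, r.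
Qed.

Lemma Gamma0P d A : d <> 1%g -> d <> g -> Gamma K g 1%g d A -> A = 0.
Proof.
move=> d1 dg /GammaP[a [b [c [p [q [r [-> h1 hg]]]]]]].
by have [-> -> -> ->] := h1 d1; have [-> ->] := hg dg; rewrite ut3_0.
Qed.

Lemma Gamma_subspace d : is_subspace (Gamma K g 1%g d).
Proof. exact: lin_span_subspace. Qed.

Lemma Gamma_lie d d' A B : Gamma K g 1%g d A -> Gamma K g 1%g d' B ->
  Gamma K g 1%g (d * d')%g (lie A B).
Proof.
have G0 e : Gamma K g 1%g e 0 by have [] := Gamma_subspace e.
have [->|d1] := pselect (d = 1%g).
  have [->|d'1] := pselect (d' = 1%g).
    move=> /Gamma1P[? [? [? [? ->]]]] /Gamma1P[? [? [? [? ->]]]].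
    by rewrite ut3_lie mulg1 !(mulr0, mul0r, oppr0, addr0, add0r); apply: Gamma1.
  have [->|d'g] := pselect (d' = g); last first.
    by move=> _ /(Gamma0P d'1 d'g) ->; rewrite lie0r; apply: G0.
  move=> /Gamma1P[? [? [? [? ->]]]] /GammagP[? [? ->]].
  by rewrite ut3_lie mul1g !(mulr0, mul0r, oppr0, addr0, add0r); apply: Gammag.
have [->|dg] := pselect (d = g); last by move=> /(Gamma0P d1 dg) -> _; rewrite lie0l; apply: G0.
have [->|d'1] := pselect (d' = 1%g).
  move=> /GammagP[? [? ->]] /Gamma1P[? [? [? [? ->]]]].
  by rewrite ut3_lie mulg1 !(mulr0, mul0r, oppr0, addr0, add0r); apply: Gammag.
have [->|d'g] := pselect (d' = g); last by move=> _ /(Gamma0P d'1 d'g) ->; rewrite lie0r; apply: G0.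
(* Elements of degree [g] commute, so whichever component [g * g] names, even that of 1, contains
   their bracket. *)
move=> /GammagP[? [? ->]] /GammagP[? [? ->]].
by rewrite ut3_lie !(mulr0, mul0r, oppr0, addr0, add0r) ut3_0; apply: G0.
Qed.

End GammaComponents.

(** * Spanning *)

Section PowerWords.
Variable G : groupType.
Implicit Type s : seq (nat * nat).

Lemma y_powersE s : y_powers G s =
  map (fun i => (i, 1%g)) (flatten [seq nseq p.2 p.1 | p <- s]).
Proof.
rewrite map_flatten -map_comp; congr flatten; apply: eq_map => p /=.
by rewrite map_nseq.
Qed.

Lemma sorted_powers s : sorted ltn (map fst s) ->
  sorted leq (flatten [seq nseq p.2 p.1 | p <- s]).
Proof.
rewrite (sorted_pairwise leq_trans) (sorted_pairwise ltn_trans).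
elim: s => //= p s IHs /andP[p_min /IHs s_sorted].
rewrite pairwise_cat s_sorted andbT; apply/andP; split.
  apply/allrelP => i j /nseqP[-> _] /flatten_mapP[q sq /nseqP[-> _]].
  by apply: ltnW; apply: (allP p_min); apply: map_f.
rewrite -(sorted_pairwise leq_trans); case: p.2 => //= k.
by elim: k => //= k ->; rewrite leqnn.
Qed.

(** The exponents are the multiplicities of the letters. Sorted words are thus equivalent to the
    power notation, and more convenient for reordering arguments. *)
Lemma sorted_word_powers (w : seq nat) : sorted leq w ->
  exists s, sorted ltn (map fst s) /\ y_powers G s = map (fun i => (i, 1%g)) w.
Proof.
move=> w_sorted; pose s := [seq (i, count_mem i w) | i <- undup w].
have fst_s : map fst s = undup w by rewrite -map_comp map_id.
have s_sorted : sorted ltn (map fst s).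
  rewrite fst_s ltn_sorted_uniq_leq undup_uniq /=.
  by apply: (subseq_sorted _ (undup_subseq w)) => //; apply: leq_trans.
exists s; split=> //; rewrite y_powersE; congr map.
apply: (sorted_eq leq_trans anti_leq) => //; first exact: sorted_powers.
by rewrite -map_comp; exact: perm_count_undup.
Qed.

Lemma type1P (g : G) c : type1 g c <-> exists j w, sorted leq w /\
  c = left_normed (MVar (j, g)) (map (fun i => (i, 1%g)) w).
Proof.
split=> [[j [s [s_sorted ->]]]|[j [w [/sorted_word_powers[s [s_sorted <-]] ->]]]].
  rewrite y_powersE; exists j, (flatten [seq nseq p.2 p.1 | p <- s]).
  by split=> //; apply: sorted_powers.
by exists j, s.
Qed.

Lemma type2P (g : G) B c : type2 g B c <-> exists m j w,
  [/\ B m, (2 <= mon_length m)%N, sorted leq w &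
    c = left_normed (MLie (mon_map (fun i => (i, 1%g)) m) (MVar (j, g)))
          (map (fun i => (i, 1%g)) w)].
Proof.
split=> [[m [j [s [Bm m2 s_sorted ->]]]]|
    [m [j [w [Bm m2 /sorted_word_powers[s [s_sorted <-]] ->]]]]].
  rewrite y_powersE; exists m, j, (flatten [seq nseq p.2 p.1 | p <- s]).
  by split=> //; apply: sorted_powers.
by exists m, j, s.
Qed.

End PowerWords.

(** An expansion of a commutator in [B] involves no single variable, by [identity_linear_part]. This
    is why type 2 only needs [m] of length at least 2. *)
Lemma derived_span (K : fieldType) (B : set (lie_mon nat)) a b :
  is_basis_mod (@identities K (UT K 2) nat) (@mon_eval K nat) B ->
  lin_span (@identities K (UT K 2) nat `|`
    @mon_eval K nat @` [set m | B m /\ (2 <= mon_length m)%N]) (lie a b).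
Proof.
move=> basisB; have idealI := @identities_ideal K nat (UT K 2).
have subI := ideal_subspace idealI.
have [s [c [us Bs Iab]]] := lin_span_modP subI (is_basis_mod_span (lie a b) basisB).
have subQ := lin_span_subspace (@identities K (UT K 2) nat `|`
  @mon_eval K nat @` [set m | B m /\ (2 <= mon_length m)%N]).
apply: (subspace_sub_trans subQ); first by apply: lin_span_in; left; exact: Iab.
apply: (subspace_sum subQ) => -[k|m1 m2] sm.
  by rewrite (identity_linear_part us Iab sm) scale0r; apply: subQ.1.
apply: (subspaceZ subQ); apply: lin_span_in; right; exists (MLie m1 m2) => //; split.
  exact: Bs.
by rewrite /= (leq_add (mon_length_gt0 m1) (mon_length_gt0 m2)).
Qed.

(** * Spanning of the free graded algebra modulo the generated ideal *)

Section RelativelyFreeSpan.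
Variables (K : fieldType) (G : groupType) (g : G).
Hypothesis K_infinite : infinite_set [set: K].
Hypothesis g_neq1 : g <> 1%g.
Notation L := (graded_free_lie K G).
Notation x i d := (fl_var K (i, d) : L).
Notation y := (fun i : nat => x i 1%g).

Variable J : set L.
Hypothesis TG_J : is_TG_ideal J.
Hypothesis J_other : forall d, d <> 1%g -> d <> g -> J (x 1%N d).
Hypothesis J_zz : J (lie (x 1%N g) (x 2%N g)).
Hypothesis J_met : J (lie (lie (y 1%N) (y 2%N)) (lie (y 3%N) (y 4%N))).
Hypothesis J_zmm :
  J (lie (lie (x 1%N g) (lie (y 2%N) (y 3%N))) (lie (y 4%N) (y 5%N))).

Let idealJ : is_lie_ideal J := TG_J.1.
Let subJ : is_subspace J := ideal_subspace idealJ.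
Let phi : free_lie K nat -> L := fl_lift y.
Let hom_phi : is_lie_hom phi := fl_lift_hom _.

(** A finite substitution fixing every unlisted variable. It turns each generator into a law for
    arbitrary homogeneous elements of the right degrees. *)
Let subst (s : seq ((nat * G) * L)) (v : nat * G) : L :=
  foldr (fun p r => if v == p.1 then p.2 else r) (fl_var K v) s.

Let subst_deg s : (forall p, p \in s -> free_comp p.1.2 p.2) ->
  forall v, free_comp v.2 (subst s v).
Proof.
elim: s => [|p s IHs] s_deg v /=; first exact: free_comp_var.
case: eqP => [->|_]; first by apply: s_deg; rewrite mem_head.
by apply: IHs => q sq; apply: s_deg; rewrite inE sq orbT.
Qed.

Let pair_eq (i j : nat) (d e : G) : ((i, d) == (j, e)) = (i == j) && (d == e).
Proof. by []. Qed.

Lemma J_var i d : d <> 1%g -> d <> g -> J (x i d).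
Proof.
move=> d1 dg; pose s := [:: ((1%N, d), x i d)].
have := TG_ideal_subst TG_J (@subst_deg s _) (J_other d1 dg).
rewrite fl_lift_var /= eqxx; apply=> p; rewrite inE => /eqP ->.
exact: free_comp_var (i, d).
Qed.

Lemma J_lie_z u v : free_comp g u -> free_comp g v -> J (lie u v).
Proof.
move=> gu gv; pose s := [:: ((1%N, g), u); ((2%N, g), v)].
have := TG_ideal_subst TG_J (@subst_deg s _) J_zz.
rewrite (fl_lift_hom _).2 !fl_lift_var /= !pair_eq !eqxx /=; apply=> p.
by rewrite !inE => /orP[] /eqP ->.
Qed.

Lemma J_metabelian a b c d : free_comp 1%g a -> free_comp 1%g b ->
  free_comp 1%g c -> free_comp 1%g d -> J (lie (lie a b) (lie c d)).
Proof.
move=> da db dc dd.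
pose s := [:: ((1%N, 1%g), a); ((2%N, 1%g), b); ((3%N, 1%g), c); ((4%N, 1%g : G), d)].
have := TG_ideal_subst TG_J (@subst_deg s _) J_met.
rewrite !(fl_lift_hom _).2 !fl_lift_var /= !pair_eq !eqxx /=; apply=> p.
by rewrite !inE => /or4P[] /eqP ->.
Qed.

Lemma J_z_der_der u a b c d : free_comp g u -> free_comp 1%g a -> free_comp 1%g b ->
  free_comp 1%g c -> free_comp 1%g d -> J (lie (lie u (lie a b)) (lie c d)).
Proof.
move=> du da db dc dd.
pose s := [:: ((1%N, g), u); ((2%N, 1%g), a); ((3%N, 1%g), b); ((4%N, 1%g), c);
  ((5%N, 1%g : G), d)].
have := TG_ideal_subst TG_J (@subst_deg s _) J_zmm.
rewrite !(fl_lift_hom _).2 !fl_lift_var /= !pair_eq !eqxx /=; apply=> p.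
by rewrite !inE => /orP[|/or4P[]] /eqP ->.
Qed.

Lemma phi_deg h : free_comp 1%g (phi h).
Proof.
apply: (free_lie_ind (P := phi @^-1` (@free_comp K G 1%g))) => [|i|a b da db].
- exact/preimage_subspace/free_comp_subspace.
- by rewrite /preimage /= /phi fl_lift_var; apply: (free_comp_var _ (i, 1%g)).
- by rewrite /preimage /= hom_phi.2 -[X in free_comp X]mulg1; apply: free_comp_lie.
Qed.

Lemma lword_deg u w : free_comp g u -> free_comp g (lword y u w).
Proof.
elim: w u => //= i w IHw u du; apply: IHw; rewrite -[g]mulg1.
by apply: free_comp_lie => //; apply: (free_comp_var _ (i, 1%g)).
Qed.

(** The preimage of [J] under [phi] is an ideal containing the metabelian law, so it contains all
    identities of [UT K 2]. *)
Lemma phi_identities h : identities (UT K 2) h -> J (phi h).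
Proof.
move: h; apply: (identities_UT2_min K_infinite) => [|a b c d].
  have [_ _ Jlie] := idealJ.
  split=> [|k a b|a b]; rewrite /preimage /=; first by rewrite (lie_hom0 hom_phi); apply: subJ.1.
    by rewrite hom_phi.1; apply: subJ.2.
  by rewrite !hom_phi.2; apply: Jlie.
by rewrite !hom_phi.2; apply: J_metabelian; apply: phi_deg.
Qed.

(** Moves the commutator leftwards through the word until it stands next to [u]. Passing [y i]
    leaves a correction with [lie (y i) (lie (phi a) (phi b))], again a commutator of images, so the
    induction covers it. *)
Lemma lword_derived (P : set L) u w a b : is_subspace P ->
  (forall v i, P v -> P (lie v (y i))) ->
  (forall a b, P (lie u (lie (phi a) (phi b)))) ->
  P (lie (lword y u w) (lie (phi a) (phi b))).
Proof.
move=> subP Py Pu; elim/last_ind: w a b => [|w i IHw] a b; first exact: Pu.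
rewrite lword_rcons lie_lie; apply: (subspaceD subP); first exact: Py.
rewrite -[lie (phi a) _]hom_phi.2 -[y i](fl_lift_var y); exact: IHw.
Qed.

Variable B : set (lie_mon nat).
Hypothesis basisB : is_basis_mod (@identities K (UT K 2) nat) (@mon_eval K nat) B.

Let S := (mon_map (fun i => (i, 1%g)) @` B) `|` @type1 G g `|` @type2 G g B.
Let Q := lin_span (J `|` @mon_eval K (nat * G) @` S).
Let subQ : is_subspace Q := lin_span_subspace _.
Let Q_J v : J v -> Q v. Proof. by move=> Jv; apply: lin_span_in; left. Qed.
Let Q_S m : S m -> Q (mon_eval K m).
Proof. by move=> Sm; apply: lin_span_in; right; exists m. Qed.
Let phi_mon m : phi (mon_eval K m) = mon_eval K (mon_map (fun i => (i, 1%g)) m).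
Proof. by rewrite mon_eval_map. Qed.
Let J_y v i : J v -> J (lie v (y i)). Proof. exact: ideal_liel. Qed.

(** After one factor from the derived algebra, law (iv) makes the remaining letters commute, so they
    can be sorted. Expanding that factor in [B] and using antisymmetry then gives commutators of
    type 2. *)
Lemma z_der_word_span j a b w :
  Q (lword y (lie (x j g) (lie (phi a) (phi b))) w).
Proof.
have zj : free_comp g (x j g : L) by exact: free_comp_var (j, g).
pose u := lie (x j g) (lie (phi a) (phi b)).
apply: (subspace_sub_trans subQ (b := lword y u (sort leq w))).
  apply: Q_J; apply: (lword_perm subJ J_y) => [v k l|]; last by rewrite perm_sym perm_sort.
  rewrite -[y k](fl_lift_var y) -[y l](fl_lift_var y).
  apply: lword_derived => // c d.
  by apply: J_z_der_der => //; apply: phi_deg.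
rewrite /u -hom_phi.2; move: (derived_span a b basisB); move: (lie a b) => h.
have lin_f : is_subspace [set h | Q (lword y (lie (x j g) (phi h)) (sort leq w))].
  split=> [|k h1 h2 Qh1 Qh2] /=.
    by rewrite (lie_hom0 hom_phi) lie0r lword0; apply: subQ.1.
  by rewrite hom_phi.1 lieDr lieZr lword_linear; apply: subQ.2.
move: h; apply: (lin_span_min lin_f) => h [Id_h|[m [Bm m2] <-]] /=.
  by apply: Q_J; apply: (lword_closed J_y); apply: ideal_lier => //; apply: phi_identities.
rewrite lieC lwordN; apply: (subspaceN subQ).
rewrite phi_mon -[lie _ _]/(mon_eval K (MLie (mon_map _ m) (MVar (j, g)))).
rewrite -(mon_eval_left_normed _ _ (fun i => (i, 1%g))); apply: Q_S; right; apply/type2P.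
by exists m, j, (sort leq w); split=> //; apply: sort_sorted leq_total _.
Qed.

(** The sorted word is of type 1. The corrections caused by sorting lie in [T], the span of [J] and
    the words just treated. *)
Lemma z_word_span j w : Q (lword y (x j g) w).
Proof.
pose T := lin_span (J `|` [set v | exists a b w,
  v = lword y (lie (x j g) (lie (phi a) (phi b))) w]).
have subT : is_subspace T := lin_span_subspace _.
have T_gen a b s : T (lword y (lie (x j g) (lie (phi a) (phi b))) s).
  by apply: lin_span_in; right; exists a, b, s.
have TQ : T `<=` Q.
  apply: (lin_span_min subQ) => v [/Q_J//|[a [b [s ->]]]]; exact: z_der_word_span.
have T_y v i : T v -> T (lie v (y i)).
  move: v; apply: (lin_span_min (subspace_liel (y i) subT)) => v [Jv|[a [b [s ->]]]] /=.
    by apply: lin_span_in; left; apply: J_y.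
  by rewrite -lword_rcons; apply: T_gen.
apply: (subspace_sub_trans subQ (b := lword y (x j g) (sort leq w))); last first.
  rewrite -(mon_eval_left_normed K (MVar (j, g)) (fun i => (i, 1%g))).
  apply: Q_S; left; right; apply/type1P; exists j, (sort leq w); split=> //.
  exact: sort_sorted leq_total _.
apply: TQ; apply: (lword_perm subT T_y) => [v k l|]; last by rewrite perm_sym perm_sort.
rewrite -[y k](fl_lift_var y) -[y l](fl_lift_var y).
by apply: lword_derived => // a b; apply: (T_gen a b [::]).
Qed.

(** The space [V] contains the variables and is closed under brackets: two elements of [W] bracket
    into [J] by (ii), and [range phi] is a subalgebra that maps [JW] into itself. *)
Lemma relatively_free_span v : Q v.
Proof.
pose W := [set u : L | exists j w, u = lword y (x j g) w].
pose JW := lin_span (J `|` W).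
have subJW : is_subspace JW := lin_span_subspace _.
pose V := lin_span (J `|` W `|` range phi).
have subV : is_subspace V := lin_span_subspace _.
have V_J u : J u -> V u by move=> Ju; apply: lin_span_in; left; left.
have V_phi h : V (phi h) by apply: lin_span_in; right; exists h.
have JW_V : JW `<=` V by apply: lin_span_mono => u; left.
have JW_W j w : JW (lword y (x j g) w) by apply: lin_span_in; right; exists j, w.
have W_deg u : W u -> free_comp g u.
  by move=> [j [w ->]]; apply: lword_deg; apply: (free_comp_var _ (j, g)).
have JW_phi h u : JW u -> JW (lie u (phi h)).
  (* The elements of the free algebra on the [y] whose action preserves [JW]: the variables are
     among them, and by the Jacobi identity so are brackets. *)
  pose P := [set h | forall u, JW u -> JW (lie u (phi h))].
  have subP : is_subspace P.
    split=> [|k h1 h2 Ph1 Ph2] t JWt.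
      by rewrite (lie_hom0 hom_phi) lie0r; apply: subJW.1.
    by rewrite hom_phi.1 lieDr lieZr; apply: subJW.2; [apply: Ph1|apply: Ph2].
  move: h u; apply: (free_lie_ind subP) => [i|h1 h2 Ph1 Ph2] u JWu.
    rewrite /phi fl_lift_var; move: u JWu.
    apply: (lin_span_min (subspace_liel (y i) subJW)) => u [Ju|[j [w ->]]] /=.
      by apply: lin_span_in; left; apply: J_y.
    by rewrite -lword_rcons.
  rewrite hom_phi.2; have -> : lie u (lie (phi h1) (phi h2)) =
      lie (lie u (phi h1)) (phi h2) - lie (lie u (phi h2)) (phi h1).
    by rewrite [lie (lie u (phi h1)) _]lie_lie addrAC subrr add0r.
  by apply: (subspaceB subJW); [apply/Ph2/Ph1|apply/Ph1/Ph2].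
suff : V v.
  move: v; apply: (lin_span_min subQ) => v [[/Q_J//|[j [w ->]]]|[h _ <-]].
    exact: z_word_span.
  move: h (is_basis_mod_span h basisB); apply: (lin_span_min (preimage_subspace hom_phi subQ)).
  move=> h [Id_h|[m Bm <-]]; first by apply: Q_J; apply: phi_identities.
  by rewrite /preimage /= phi_mon; apply: Q_S; left; left; exists m.
move: v; apply: (free_lie_ind subV) => [[i d]|].
  have [->|d1] := pselect (d = 1%g); first by rewrite -(fl_lift_var y).
  have [->|dg] := pselect (d = g); first by apply/JW_V/(JW_W i [::]).
  exact/V_J/J_var.
apply: (lin_span_lie subV) => a b [[Ja|Wa]|[h _ <-]].
- by move=> _; exact: V_J (ideal_liel _ idealJ Ja).
- move=> [[Jb|Wb]|[h _ <-]]; first exact: V_J (ideal_lier _ idealJ Jb).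
    by apply/V_J/J_lie_z; apply: W_deg.
  by apply/JW_V/JW_phi; apply: lin_span_in; right.
- move=> [[Jb|Wb]|[h' _ <-]]; first exact: V_J (ideal_lier _ idealJ Jb).
    rewrite lieC; apply: (subspaceN subV); apply/JW_V/JW_phi.
    by apply: lin_span_in; right.
  by rewrite -hom_phi.2.
Qed.

End RelativelyFreeSpan.

(** * Independence *)

Section RelativelyFreeIndependence.
Variables (K : fieldType) (G : groupType) (g : G).
Hypothesis g_neq1 : g <> 1%g.
Notation L := (graded_free_lie K G).
Notation Id := (@graded_identities K G (UT K 3) (Gamma K g 1%g)).
Notation x i d := (fl_var K (i, d) : L).
Notation y := (fun i : nat => x i 1%g).
Notation inc := (mon_map (fun i : nat => (i, 1%g : G))).

Lemma Gamma_id_other d : d <> 1%g -> d <> g -> Id (x 1%N d).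
Proof.
move=> d1 dg phi [_ phi_gr].
exact: (Gamma0P g_neq1 d1 dg (phi_gr _ _ (free_comp_var K (1%N, d)))).
Qed.

Lemma Gamma_id_zz : Id (lie (x 1%N g) (x 2%N g)).
Proof.
move=> phi [hphi phi_gr]; rewrite hphi.2.
have [? [? ->]] := GammagP g_neq1 (phi_gr _ _ (free_comp_var K (1%N, g))).
have [? [? ->]] := GammagP g_neq1 (phi_gr _ _ (free_comp_var K (2%N, g))).
by rewrite ut3_lie -ut3_0; congr (ut3 _ _ _ _ _ _); ring.
Qed.

Lemma Gamma_id_met : Id (lie (lie (y 1%N) (y 2%N)) (lie (y 3%N) (y 4%N))).
Proof.
move=> phi [hphi phi_gr]; rewrite !hphi.2.
have phi_y i := Gamma1P g_neq1 (phi_gr _ _ (free_comp_var K (i, 1%g : G))).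
have [? [? [? [? ->]]]] := phi_y 1%N; have [? [? [? [? ->]]]] := phi_y 2%N.
have [? [? [? [? ->]]]] := phi_y 3%N; have [? [? [? [? ->]]]] := phi_y 4%N.
by rewrite !ut3_lie -ut3_0; congr (ut3 _ _ _ _ _ _); ring.
Qed.

(** Commutators of the [y] go to multiples of [e_23], so the inner bracket goes to a multiple of
    [e_13], which commutes with [e_23]. *)
Lemma Gamma_id_zmm :
  Id (lie (lie (x 1%N g) (lie (y 2%N) (y 3%N))) (lie (y 4%N) (y 5%N))).
Proof.
move=> phi [hphi phi_gr]; rewrite !hphi.2.
have phi_y i := Gamma1P g_neq1 (phi_gr _ _ (free_comp_var K (i, 1%g : G))).
have [? [? [? [? ->]]]] := phi_y 2%N; have [? [? [? [? ->]]]] := phi_y 3%N.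
have [? [? [? [? ->]]]] := phi_y 4%N; have [? [? [? [? ->]]]] := phi_y 5%N.
have [? [? ->]] := GammagP g_neq1 (phi_gr _ _ (free_comp_var K (1%N, g))).
by rewrite !ut3_lie -ut3_0; congr (ut3 _ _ _ _ _ _); ring.
Qed.

Section Evaluation.
Variables (h : free_lie K nat -> UT K 2) (hom_h : is_lie_hom h) (l u : nat -> K).

Let hb i := val (h (fl_var K i)) ord0 ord0.
Let hd i := val (h (fl_var K i)) ord_max ord_max.
Let hq (m : lie_mon nat) := val (h (mon_eval K m)) ord0 ord_max.
Let Y i := ut3 0 (hb i + l i) (hd i + l i) 0 (hq (MVar i)) 0.

(* Sends [y_i] to the block sum of [0] and [h y_i + l_i I], and [z_j] to [u_j e_12]. *)
Definition shifted_eval : L -> UT K 3 :=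
  fl_lift (fun v => if v.2 == 1%g then Y v.1
                    else if v.2 == g then ut3 0 0 0 (u v.1) 0 0 else 0).
Notation ev := shifted_eval.

Lemma shifted_eval_graded : is_graded_hom (@free_comp K G) (Gamma K g 1%g) ev.
Proof.
apply: graded_lift => [d|d d' a b|v]; [exact: Gamma_subspace|exact: Gamma_lie|].
case: eqP => [->|_]; first exact: Gamma1.
case: eqP => [->|_]; first exact: Gammag.
by have [] := @Gamma_subspace K G g v.2.
Qed.

Let hom_ev := shifted_eval_graded.1.

Let ev_y i : ev (y i) = Y i.
Proof. by rewrite /ev fl_lift_var eqxx. Qed.

Let ev_z j : ev (x j g) = ut3 0 0 0 (u j) 0 0.
Proof. by rewrite /ev fl_lift_var /= eqxx; case: eqP. Qed.

(** Adding scalars to the block changes no commutator, so the shift [k] is visible on single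
    variables only, and there only on the diagonal. *)
Lemma shifted_eval_y m : exists a b q, h (mon_eval K m) = ut2 a b q /\
  let k := if m is MVar i then l i else 0 in
  ev (mon_eval K (inc m)) = ut3 0 (a + k) (b + k) 0 q 0.
Proof.
elim: m => [i|m1 [a1 [b1 [q1 [h1 ev1]]]] m2 [a2 [b2 [q2 [h2 ev2]]]]] /=.
  rewrite ev_y /Y /hb /hd /hq /=; have [a [b [q ->]]] := ut2P (h (fl_var K i)).
  by exists a, b, q; rewrite !mxE.
rewrite hom_h.2 hom_ev.2 h1 h2 ev1 ev2 ut2_lie ut3_lie; do 3!eexists; split.
  reflexivity.
by congr (ut3 _ _ _ _ _ _); ring.
Qed.

(** The row [(p, r)] is multiplied successively by triangular blocks. The [e_12] entry is always a
    pure product; the [e_13] entry is one only if [p = 0], since otherwise [p] feeds into it. *)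
Let ev_lword p r w : exists r', 
  lword Y (ut3 0 0 0 p 0 r) w = ut3 0 0 0 (p * \prod_(i <- w) (hb i + l i)) 0 r' /\
  (p = 0 -> r' = r * \prod_(i <- w) (hd i + l i)).
Proof.
elim: w p r => [|i w IHw] p r /=.
  by exists r; rewrite !big_nil !mulr1.
rewrite ut3_lie; rewrite !big_cons.
have [r' [eq_r' p0]] := IHw (p * (hb i + l i)) (p * hq (MVar i) + r * (hd i + l i)).
exists r'; split; first by rewrite mulrA -eq_r'; congr (lword _ (ut3 _ _ _ _ _ _)); ring.
by move=> p_eq0; rewrite p0 p_eq0 ?mul0r // add0r mulrA.
Qed.

Lemma shifted_eval_type1 j w : exists r,
  ev (mon_eval K (left_normed (MVar (j, g)) (map (fun i => (i, 1%g)) w))) =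
  ut3 0 0 0 (u j * \prod_(i <- w) (hb i + l i)) 0 r.
Proof.
rewrite mon_eval_left_normed (lie_hom_lword hom_ev) ev_z.
have -> : ev \o y = Y by apply: funext => i; apply: ev_y.
by have [r [-> _]] := ev_lword (u j) 0 w; exists r.
Qed.

(** As [m] is a commutator, it goes to a multiple of [e_23], and its bracket with [u_j e_12] is a
    multiple of [e_13]. This is the case [p = 0] of [ev_lword]. *)
Lemma shifted_eval_type2 m j w : (2 <= mon_length m)%N ->
  ev (mon_eval K (left_normed (MLie (inc m) (MVar (j, g))) (map (fun i => (i, 1%g)) w))) =
  ut3 0 0 0 0 0 (- (u j * hq m) * \prod_(i <- w) (hd i + l i)).
Proof.
case: m => // m1 m2 _; rewrite mon_eval_left_normed (lie_hom_lword hom_ev).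
have -> : ev \o y = Y by apply: funext => i; apply: ev_y.
have [a [b [q [hm ev_m]]]] := shifted_eval_y (MLie m1 m2).
have [a0 b0] : a = 0 /\ b = 0.
  move: hm; rewrite /= hom_h.2; have [? [? [? ->]]] := ut2P (h (mon_eval K m1)).
  have [? [? [? ->]]] := ut2P (h (mon_eval K m2)); rewrite ut2_lie.
  move=> /(congr1 (fun A : UT K 2 => (val A ord0 ord0, val A ord_max ord_max))).
  by rewrite !mxE /= => -[<- <-].
rewrite -[mon_eval K (MLie _ _)]/(lie (mon_eval K (inc (MLie m1 m2))) (x j g)).
rewrite hom_ev.2 ev_m ev_z /hq hm mxE /= a0 b0 !addr0 ut3_lie.
have [r [eq_r p0]] := ev_lword 0 (- (u j * q)) w.
rewrite p0 // mul0r in eq_r.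
by rewrite -eq_r; congr (lword _ (ut3 _ _ _ _ _ _)); ring.
Qed.

End Evaluation.

End RelativelyFreeIndependence.

(** * Vanishing of the three kinds of coefficients *)

Section RelativelyFreeBasis.
Variables (K : fieldType) (G : groupType) (g : G).
Hypothesis K_infinite : infinite_set [set: K].
Hypothesis g_neq1 : g <> 1%g.
Notation L := (graded_free_lie K G).
Notation Id := (@graded_identities K G (UT K 3) (Gamma K g 1%g)).
Notation inc := (mon_map (fun i : nat => (i, 1%g : G))).
Let o1 : 'I_3 := Ordinal (isT : 1 < 3)%N.
Let T1 j w : lie_mon (nat * G) := left_normed (MVar (j, g)) (map (fun i => (i, 1%g)) w).
Let T2 m j w : lie_mon (nat * G) :=
  left_normed (MLie (inc m) (MVar (j, g))) (map (fun i => (i, 1%g)) w).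

Variable B : set (lie_mon nat).
Hypothesis basisB : is_basis_mod (@identities K (UT K 2) nat) (@mon_eval K nat) B.
Notation S := ((inc @` B) `|` @type1 G g `|` @type2 G g B).

Variables (s : seq (lie_mon (nat * G))) (c : lie_mon (nat * G) -> K).
Hypothesis uniq_s : uniq s.
Hypothesis s_S : forall m, m \in s -> S m.
Hypothesis Id_s : Id (\sum_(m <- s) c m *: mon_eval K m).

Let Id_entry h (hom_h : is_lie_hom h) l u i j :
  \sum_(m <- s) c m * val (shifted_eval g h l u (mon_eval K m)) i j = 0.
Proof.
have ev_gr := shifted_eval_graded g_neq1 h l u.
have := Id_s ev_gr; rewrite (lie_hom_sum ev_gr.1).
under eq_bigr do rewrite (lie_homZ ev_gr.1).
by move=> /(congr1 (fun A : UT K 3 => val A i j)) /=; rewrite UT_entry_sum mxE.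
Qed.

(** Words containing a [z] only have entries in the first row, so the lower right block of an
    unshifted evaluation sees [B] alone, through an arbitrary homomorphism [h] to [UT K 2]. The
    relation thus becomes one modulo the identities of [UT K 2]. *)
Lemma basis_coef_eq0 m : m \in s -> (inc @` B) m -> c m = 0.
Proof.
move=> sm [m0 Bm0 def_m].
pose inB (x : lie_mon (nat * G)) := `[< (inc @` B) x >].
pose un := @mon_map (nat * G) nat fst.
have incK : cancel inc un by apply: mon_mapK.
have unK x : inB x -> inc (un x) = x.
  by move=> /asboolP[n _ <-]; rewrite incK.
pose s' := [seq un x | x <- s & inB x].
have s'_B n : n \in s' -> B n.
  move=> /mapP[x]; rewrite mem_filter => /andP[/asboolP[n' Bn' <-] _] ->.
  by rewrite incK.
have us' : uniq s'.
  rewrite map_inj_in_uniq ?filter_uniq // => x1 x2.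
  rewrite !mem_filter => /andP[/unK x1K _] /andP[/unK x2K _] eq_x.
  by rewrite -x1K -x2K eq_x.
have s'm0 : m0 \in s'.
  apply/mapP; exists m; last by rewrite -def_m incK.
  by rewrite mem_filter sm andbT; apply/asboolP; exists m0.
rewrite -def_m; apply: (basisB.1 s' (c \o inc) us' s'_B) s'm0.
move=> h hom_h; rewrite (lie_hom_sum hom_h).
apply/val_inj/matrixP => i j.
under eq_bigr do rewrite (lie_homZ hom_h).
rewrite UT_entry_sum [RHS]mxE.
(* [lift ord0] selects the lower right block, where [h] itself sits. *)
rewrite -[RHS](Id_entry hom_h (fun=> 0) (fun=> 0) (lift ord0 i) (lift ord0 j)).
rewrite big_map big_filter big_mkcond /= [LHS]big_seq [RHS]big_seq.
apply: eq_bigr => x sx; case: ifP => [xB|/asboolP xB].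
  rewrite unK //; congr (_ * _).
  have [a [b [q [-> ]]]] := shifted_eval_y g_neq1 hom_h (fun=> 0) (fun=> 0) (un x).
  rewrite unK //; case: (un x) => [_|_ _] /= ->.
    by rewrite !mxE !addr0; case: i j => [[|[|//]] ?] [[|[|//]] ?].
  by rewrite !mxE !addr0; case: i j => [[|[|//]] ?] [[|[|//]] ?].
have [[//|/type1P[j' [w [_ ->]]]]|/type2P[n [j' [w [_ n2 _ ->]]]]] := s_S sx.
  have [r ->] := shifted_eval_type1 g_neq1 h (fun=> 0) (fun=> 0) j' w.
  by rewrite mxE; case: i j => [[|[|//]] ?] [[|[|//]] ?]; rewrite mulr0.
rewrite shifted_eval_type2 // mxE.
by case: i j => [[|[|//]] ?] [[|[|//]] ?]; rewrite mulr0.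
Qed.

Let row0_B m h (hom_h : is_lie_hom h) l u j :
  (inc @` B) m -> val (shifted_eval g h l u (mon_eval K m)) ord0 j = 0.
Proof.
move=> [n _ <-]; have [a [b [q [_ ->]]]] := shifted_eval_y g_neq1 hom_h l u n.
by rewrite mxE; case: j => [[|[|[|//]]] ?].
Qed.

(** In the entry [e_12] both [B] and type 2 vanish, while a type 1 commutator gives [u_j] times the
    monomial of its word. Choosing [u] as the indicator of [j0] isolates one [z], and a sorted word
    is determined by its monomial. *)
Lemma type1_coef_eq0 m : m \in s -> type1 g m -> c m = 0.
Proof.
move=> sm m1.
have /choice[dec dec1] (x : lie_mon (nat * G)) : exists d : nat * seq nat,
    type1 g x -> sorted leq d.2 /\ x = T1 d.1 d.2.
  have [/type1P[j [w w_x]]|] := pselect (type1 g x); first by exists (j, w).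
  by exists (0%N, [::]).
pose j0 := (dec m).1; pose w0 := (dec m).2.
have [w0_sorted def_m] := dec1 m m1; rewrite -/j0 -/w0 in w0_sorted def_m.
pose is1 (x : lie_mon (nat * G)) := `[< type1 g x >].
pose a x := if is1 x then c x * ((dec x).1 == j0)%:R else 0.
have /(word_poly_coef_eq0 K_infinite w0) :
    forall t : nat -> K, \sum_(x <- s) a x * \prod_(i <- (dec x).2) t i = 0.
  move=> t; pose h := fl_lift (fun i => ut2 (t i) 0 0).
  have hom_h : is_lie_hom h := fl_lift_hom _.
  have h_t i : val (h (fl_var K i)) ord0 ord0 = t i by rewrite /h fl_lift_var mxE.
  rewrite -[RHS](Id_entry hom_h (fun=> 0) (fun j => (j == j0)%:R) ord0 o1).
  rewrite [LHS]big_seq [RHS]big_seq; apply: eq_bigr => x sx; rewrite /a.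
  case: ifP => [/asboolP/dec1[_ /(congr1 (@mon_eval K _)) ->]|/asboolP x1].
    have [r ->] := shifted_eval_type1 g_neq1 h (fun=> 0) (fun j => (j == j0)%:R)
      (dec x).1 (dec x).2.
    rewrite mxE /= -mulrA; congr (_ * (_ * _)).
    by apply: eq_bigr => i _; rewrite h_t addr0.
  rewrite mul0r; have [[xB|//]|/type2P[n [j [w [_ n2 _ ->]]]]] := s_S sx.
    by rewrite row0_B ?mulr0.
  by rewrite shifted_eval_type2 // mxE mulr0.
have unique x : type1 g x -> (dec x).1 = j0 -> perm_eq (dec x).2 w0 -> x = m.
  move=> /dec1[x_sorted x_T] xj /(sorted_eq leq_trans anti_leq x_sorted w0_sorted) xw.
  by rewrite x_T xj xw.
rewrite big_mkcond (bigD1_seq _ sm uniq_s) /= perm_refl big1_seq => [|x /andP[x_neq sx]].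
  have is1_m : is1 m by apply/asboolP.
  by rewrite /a is1_m eqxx mulr1 addr0.
rewrite /a; case: ifP => // perm_x; case: ifP => // /asboolP x1.
by case: eqP => [xj|_]; [case/eqP: x_neq; apply: unique|rewrite mulr0].
Qed.

(** Fix the variable [z] and the word [w0]. For every [h], the coefficient of the monomial of [w0]
    in the [e_13] entry is, up to sign, the [e_12] entry of the combination of the corresponding
    [m]. These are commutators, so the combination is an identity of [UT K 2], and independence of
    [B] applies. *)
Lemma type2_coef_eq0 m : m \in s -> type2 g B m -> c m = 0.
Proof.
move=> sm m2.
have /choice[dec dec2] (x : lie_mon (nat * G)) : exists d : lie_mon nat * nat * seq nat,
    type2 g B x -> [/\ B d.1.1, (2 <= mon_length d.1.1)%N, sorted leq d.2 &
      x = T2 d.1.1 d.1.2 d.2].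
  have [/type2P[n [j [w w_x]]]|] := pselect (type2 g B x); first by exists (n, j, w).
  by exists (MVar 0%N, 0%N, [::]).
pose j0 := (dec m).1.2; pose w0 := (dec m).2.
have [_ _ w0_sorted def_m] := dec2 m m2; rewrite -/j0 -/w0 in w0_sorted def_m.
pose is2 (x : lie_mon (nat * G)) := `[< type2 g B x >].
(* The type 2 commutators with the same [z] and the same word as [m]; they differ only in their
   factor from [B]. *)
pose s2 := [seq x <- s | [&& is2 x, (dec x).1.2 == j0 & perm_eq (dec x).2 w0]].
have s2T x : x \in s2 -> type2 g B x /\ x = T2 (dec x).1.1 j0 w0.
  rewrite mem_filter => /andP[/and3P[/asboolP x2 /eqP xj perm_x] _]; split=> //.
  have [_ _ x_sorted] := dec2 x x2.
  by rewrite xj (sorted_eq leq_trans anti_leq x_sorted w0_sorted perm_x).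
pose s' := [seq (dec x).1.1 | x <- s2].
have s2m : m \in s2.
  by rewrite mem_filter sm andbT !eqxx perm_refl !andbT; apply/asboolP.
have us' : uniq s'.
  rewrite map_inj_in_uniq ?filter_uniq // => x1 x2 /s2T[_ def_x1] /s2T[_ def_x2] eq_x.
  by rewrite def_x1 def_x2 eq_x.
have s'_B n : n \in s' -> B n by move=> /mapP[x /s2T[/dec2[Bx _ _ _] _] ->].
rewrite def_m.
have s'm : (dec m).1.1 \in s' by apply: map_f.
apply: (basisB.1 s' (fun n => c (T2 n j0 w0)) us' s'_B) s'm => h hom_h.
rewrite big_map (eq_big_seq (fun x => c x *: mon_eval K (dec x).1.1)); last first.
  by move=> x /s2T[_ x_T] /=; rewrite -x_T.
pose q x := val (h (mon_eval K (dec x).1.1)) ord0 ord_max.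
have h_der x : type2 g B x -> h (mon_eval K (dec x).1.1) = ut2 0 0 (q x).
  move=> /dec2[_]; rewrite /q; case: (dec x).1.1 => // n1 n2 _ _ _ /=.
  rewrite hom_h.2; have [? [? [? ->]]] := ut2P (h (mon_eval K n1)).
  by have [? [? [? ->]]] := ut2P (h (mon_eval K n2)); rewrite ut2_lie mxE.
suff q_sum : \sum_(x <- s2) c x * q x = 0.
  rewrite (lie_hom_sum hom_h) (eq_big_seq (fun x => c x *: ut2 0 0 (q x))); last first.
    by move=> x /s2T[x2 _]; rewrite (lie_homZ hom_h) h_der.
  apply/val_inj/matrixP => i j; rewrite UT_entry_sum [RHS]mxE.
  case: i j => [[|[|//]] ?] [[|[|//]] ?];
    first [by rewrite big1 // => x _; rewrite mxE mulr0
          |by rewrite -[RHS]q_sum; apply: eq_bigr => x _; rewrite mxE].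
pose a x := if is2 x && ((dec x).1.2 == j0) then - (c x * q x) else 0.
have /(word_poly_coef_eq0 K_infinite w0) :
    forall t : nat -> K, \sum_(x <- s) a x * \prod_(i <- (dec x).2) t i = 0.
  (* The shift makes the second diagonal entry of the block equal to the free parameter [t i],
     whatever [h] is. *)
  move=> t; pose l i := t i - val (h (fl_var K i)) ord_max ord_max.
  rewrite -[RHS](Id_entry hom_h l (fun j => (j == j0)%:R) ord0 ord_max).
  rewrite [LHS]big_seq [RHS]big_seq; apply: eq_bigr => x sx; rewrite /a.
  case: (boolP (is2 x)) => [/asboolP x2|/asboolP x2] /=.
    have [_ n2 _ /(congr1 (@mon_eval K _)) ->] := dec2 x x2.
    rewrite shifted_eval_type2 // mxE /= -/(q x).
    under [in RHS]eq_bigr do rewrite /l addrC subrK.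
    by case: eqP => _; rewrite ?mulr1n ?mulr0n; ring.
  have [[xB|x1]|//] := s_S sx; first by rewrite row0_B // mulr0 mul0r.
  (* The [e_13] entry of a type 1 commutator is not controlled, but its coefficient is already known
     to vanish. *)
  by rewrite type1_coef_eq0 // !mul0r.
move=> a_sum; apply/eqP; rewrite -oppr_eq0 -sumrN; apply/eqP.
rewrite -[RHS]a_sum big_filter big_mkcond [RHS]big_mkcond; apply: eq_bigr => x _.
by rewrite /a; case: (is2 x); case: (_ == j0); case: (perm_eq _ _).
Qed.

End RelativelyFreeBasis.

Lemma Gamma_identities_free (K : fieldType) (G : groupType) (g : G) (B : set (lie_mon nat)) :
  infinite_set [set: K] -> g <> 1%g ->
  is_basis_mod (@identities K (UT K 2) nat) (@mon_eval K nat) B ->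
  free_mod (@graded_identities K G (UT K 3) (Gamma K g 1%g)) (@mon_eval K (nat * G))
    ((mon_map (fun i => (i, 1%g)) @` B) `|` type1 g `|` type2 g B).
Proof.
move=> K_infinite g_neq1 basisB s c uniq_s s_S Id_s m sm.
have [[mB|m1]|m2] := s_S m sm.
- exact: (basis_coef_eq0 g_neq1 basisB uniq_s s_S Id_s).
- exact: (type1_coef_eq0 K_infinite g_neq1 uniq_s s_S Id_s).
- exact: (type2_coef_eq0 K_infinite g_neq1 basisB uniq_s s_S Id_s).
Qed.

Theorem theorem3p31 (K : fieldType) (G : groupType) (g : G)
    (K_infinite : infinite_set [set: K])
    (G_abelian : forall a b : G, (a * b)%g = (b * a)%g)
    (g_neq1 : g <> 1%g) :
  let L := graded_free_lie K G in
  let x (i : nat) (d : G) : L := fl_var K (i, d) in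
  let y (i : nat) : L := x i 1%g in
  let z (i : nat) : L := x i g in
  let Id : set L := graded_identities (Gamma K g 1%g) in
  Id = smallest (@is_TG_ideal K G)
         ([set x 1%N l | l in [set l | l <> 1%g /\ l <> g]]
          `|` [set lie (z 1%N) (z 2%N)]
          `|` [set lie (lie (y 1%N) (y 2%N)) (lie (y 3%N) (y 4%N))]
          `|` [set lie (lie (z 1%N) (lie (y 2%N) (y 3%N)))
                       (lie (y 4%N) (y 5%N))])
  /\
  forall B : set (lie_mon nat),
    is_basis_mod (@identities K (UT K 2) nat) (@mon_eval K nat) B ->
    is_basis_mod Id (@mon_eval K (nat * G))
      ((mon_map (fun i => (i, 1%g)) @` B) `|` type1 g `|` type2 g B).
Proof.
move=> L x y z Id; set gens := _ `|` _; pose J := smallest (@is_TG_ideal K G) gens.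
have TG_J : is_TG_ideal J := smallest_TG_ideal gens.
have TG_Id : is_TG_ideal Id := graded_identities_TG_ideal _.
have J_gens : gens `<=` J := @sub_gen_smallest _ _ _.
have subId := ideal_subspace TG_Id.1.
have J_Id : J `<=` Id.
  apply: smallest_sub => // _ [[[[d [d1 dg] <-]|->]|->]|->].
  - exact: Gamma_id_other.
  - exact: Gamma_id_zz.
  - exact: Gamma_id_met.
  - exact: Gamma_id_zmm.
have J_span B : is_basis_mod (@identities K (UT K 2) nat) (@mon_eval K nat) B ->
    forall v, lin_span (J `|` @mon_eval K (nat * G) @`
      ((mon_map (fun i => (i, 1%g)) @` B) `|` type1 g `|` type2 g B)) v.
  move=> basisB; apply: relatively_free_span => // [d d1 dg|||]; apply: J_gens.
  - by left; left; left; exists d.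
  - by left; left; right.
  - by left; right.
  - by right.
(* The equality does not mention [B], so it is derived from the explicit basis [met_mons]. *)
have Id_J : Id = J.
  apply: (span_free_eq (ideal_subspace TG_J.1) subId J_Id (J_span _ (met_mons_basis K_infinite))).
  exact: Gamma_identities_free (met_mons_basis K_infinite).
split=> // B basisB; apply: is_basis_modI => //; first exact: Gamma_identities_free.
by rewrite Id_J; apply: J_span.
Qed.
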